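(* Fix integers $2 \le r_1 < r_2$ and let $\mathbf H_n = (H_n^{(1)}, H_n^{(2)})$, $n\ge1$, be a sequence of 2-hypermultiplexes, where $H_n^{(1)}$ is $r_1$-uniform and $H_n^{(2)}$ is $r_2$-uniform. Suppose the vertices of $\mathbf H_n$ are colored uniformly at random with $c_n$ colors, where $c_n\to\infty$, such that for each $i \in \{1,2\}$, $$\lim_{n \to \infty}\mathbb{E}[T(H_n^{(i)})] = \lim_{n \to \infty}\mathrm{Var}[T(H_n^{(i)})] = \lambda_i$$ for some constant $\lambda_i \geq 0$. Then, as $n\to\infty$, $\mathbf T(\mathbf H_n)$ converges in distribution to $(Z_1, Z_2)^\top$, where $Z_1 \sim \mathrm{Pois}(\lambda_1)$ and $Z_2 \sim \mathrm{Pois}(\lambda_2)$ are independent.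
   Context: An $r$-uniform hypergraph $H=(V(H),E(H))$ consists of a finite vertex set $V(H)$ and a set $E(H)$ of $r$-element subsets of $V(H)$, called hyperedges. A 2-hypermultiplex is a pair $\mathbf H_n=(H_n^{(1)},H_n^{(2)})$ of uniform hypergraphs with a common vertex set $V_n$. ''Colored uniformly at random with $c_n$ colors'' means each $v\in V_n$ gets a color $X_v$ uniform on $\{1,\dots,c_n\}$, independently over the vertices (a single coloring is used for both layers). $T(H_n^{(i)})=\sum_{e\in E(H_n^{(i)})}\mathbf 1\{X_v=X_{v'}\ \forall v,v'\in e\}$ is the number of monochromatic hyperedges of $H_n^{(i)}$, and $\mathbf T(\mathbf H_n)=(T(H_n^{(1)}),T(H_n^{(2)}))^\top$. $\mathrm{Pois}(0)$ is the point mass at $0$. *)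

(* Defs.v *)
From mathcomp Require Import all_boot all_order all_algebra.
From mathcomp Require Import all_classical all_reals all_analysis.

Set Implicit Arguments.
Unset Strict Implicit.
Unset Printing Implicit Defensive.

Import Order.TTheory GRing.Theory Num.Theory.
Import numFieldNormedType.Exports.

Local Open Scope classical_set_scope.
Local Open Scope ring_scope.

Record uniform_hypergraph (r : nat) (V : finType) := UniformHypergraph {
  hyperedges : {set {set V}};
  card_hyperedge : forall e : {set V}, e \in hyperedges -> #|e| = r }.

Record hypermultiplex2 (r1 r2 : nat) := Hypermultiplex2 {
  vertices : finType;
  layer1 : uniform_hypergraph r1 vertices;
  layer2 : uniform_hypergraph r2 vertices }.

Definition monochromatic (V : finType) (x : V -> nat) (e : {set V}) : bool :=
  [forall v in e, forall w in e, x v == x w].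

Definition nb_monochromatic (r : nat) (V : finType)
    (H : uniform_hypergraph r V) (x : V -> nat) : nat :=
  (\sum_(e in hyperedges H) nat_of_bool (monochromatic x e))%N.

Definition mutually_independent d d' (Omega : measurableType d)
    (E : measurableType d') (R : realType) (P : probability Omega R)
    (I : finType) (X : I -> {RV P >-> E}) : Prop :=
  forall (J : {set I}) (A : I -> set E),
    (forall i, i \in J -> measurable (A i)) ->
    P (\bigcap_(i in [set` J]) (X i @^-1` A i))
      = (\prod_(i in J) P (X i @^-1` A i))%E.

Definition independent d d1 d2 (Omega : measurableType d)
    (E1 : measurableType d1) (E2 : measurableType d2) (R : realType)
    (P : probability Omega R)
    (X1 : {RV P >-> E1}) (X2 : {RV P >-> E2}) : Prop :=
  forall (A1 : set E1) (A2 : set E2), measurable A1 -> measurable A2 ->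
    P ((X1 @^-1` A1) `&` (X2 @^-1` A2))
      = (P (X1 @^-1` A1) * P (X2 @^-1` A2))%E.

Definition uniform_color d (Omega : measurableType d) (R : realType)
    (P : probability Omega R) (c : nat) (X : {RV P >-> nat}) : Prop :=
  forall k : nat,
    distribution P X [set k] = (if (1 <= k <= c)%N then c%:R^-1 else 0)%:E.

Definition uniform_coloring d (Omega : measurableType d) (R : realType)
    (P : probability Omega R) (V : finType) (c : nat)
    (X : V -> {RV P >-> nat}) : Prop :=
  (forall v, uniform_color c (X v)) /\ mutually_independent X.

(* The trailing nat argument of [poisson_prob] is unused by its definition;
   for rate 0, [poisson_prob] is the Dirac mass at 0. *)
Definition has_poisson_law d (Omega : measurableType d) (R : realType)
    (P : probability Omega R) (Z : {RV P >-> nat}) (lambda : R) : Prop :=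
  forall A : set nat, distribution P Z A = poisson_prob lambda 0%N A.

Definition T_mono d (Omega : measurableType d) (R : realType)
    (P : probability Omega R) (r : nat) (V : finType)
    (H : uniform_hypergraph r V) (X : V -> {RV P >-> nat}) : Omega -> R :=
  fun w => (nb_monochromatic H (fun v => X v w))%:R.

(* Weak convergence; the random elements may live on different probability
   spaces. *)
Definition cvg_in_distribution (R : realType) (E : topologicalType)
    (d : nat -> measure_display) (Omega : forall n, measurableType (d n))
    (P : forall n, probability (Omega n) R) (Y : forall n, Omega n -> E)
    (d' : measure_display) (Omega' : measurableType d')
    (P' : probability Omega' R) (Z : Omega' -> E) : Prop :=
  forall f : E -> R, continuous f -> bounded_fun f ->
    ('E_(P n)[f \o Y n] @[n --> \oo] --> 'E_P'[f \o Z])%E.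

(* Main.v *)
Require Import Defs.
From mathcomp Require Import all_boot all_order all_algebra.
From mathcomp Require Import all_classical all_reals all_analysis measurable_realfun.
From mathcomp Require Import zify ring lra.
Import Order.TTheory GRing.Theory Num.Theory.
Import numFieldNormedType.Exports.
Set Implicit Arguments.
Unset Strict Implicit.
Unset Printing Implicit Defensive.
Local Open Scope ring_scope.

(** The proof is a Stein-Chen coupling argument in which Stein's equation is
    replaced by a recurrence for the joint probabilities.

    Let q = 1/c, let p e = q ^ (|e| - 1) be the probability that the edge e is
    monochromatic, and let N1, N2 be the numbers of monochromatic edges of the
    two layers.  Conditioning on e being monochromatic amounts to recoloring e
    with the color of any one of its vertices, its root
    ([average_mono_recolor]).  Summing over the edges e of the first layer,
    (k+1) P(N1 = k+1, N2 = l) is the sum of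
    p e * P(N1 = k+1, N2 = l after recoloring e), and after recoloring e one
    typically has exactly one more monochromatic edge than before, namely e.
    Hence
      (k+1) P(N1 = k+1, N2 = l) - E[N1] P(N1 = k, N2 = l)
    is at most the sum over e of p e times the probability that this fails,
    that is, that e was monochromatic already or that the recoloring creates or
    destroys another monochromatic edge ([stein_edge]); similarly with the
    layers exchanged.

    The first event costs p e <= q. The other error has two sources. An edge
    f sharing at least two vertices with e contributes p (e U f); the total
    over e and f is called the overlap. Inside one layer the covariance of
    two distinct edges is nonnegative, and comparable to p (e U f) when they
    share two vertices, so Var - E -> 0 makes the overlap vanish
    ([overlap_le_variance]). Between the layers, grouping the pairs by the
    common subset S and applying the inequality of arithmetic and geometric
    means bounds the overlap by those of the two layers, plus a diagonal
    term that is small because r1 < r2 ([cross_overlap]). An edge f meeting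
    e in one vertex only contributes when that vertex is not the root. The
    root is therefore chosen of maximal weighted degree in e: a contribution
    is then large only for edges containing two vertices of large degree;
    few pairs of vertices have large degrees, and the codegree of each pair
    is small by the overlap bound ([codegree_sqr], [exists_root],
    [sum_pair_energy]).

    In the limit the joint probabilities thus satisfy the recurrences that
    characterize the product of Poisson weights up to a constant; Markov's
    inequality prevents the loss of mass and determines the constant
    ([cvg_poisson_recurrence]).  Convergence of all atoms to a probability
    distribution gives convergence in distribution
    ([cvg_expectation_discrete]). *)

(** * Averages over uniform colorings *)

(** The shift makes the colors range over 1, ..., c. *)
Definition color (V : finType) (c : nat) (x : {ffun V -> 'I_c}) : V -> nat :=
  fun v => (x v).+1.

Notation mono x e := (monochromatic (color x) e).

Definition average (R : realFieldType) (V : finType) (c : nat)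
    (F : {ffun V -> 'I_c} -> R) : R :=
  (\sum_x F x) / (c ^ #|V|)%:R.

Definition recolor (V : finType) (c : nat) (e : {set V}) (u : V)
    (x : {ffun V -> 'I_c}) : {ffun V -> 'I_c} :=
  [ffun v => if v \in e then x u else x v].

Section Average.
Context (R : realFieldType) (V : finType) (c : nat).
Hypothesis c_gt0 : (0 < c)%N.
Implicit Types (F G : {ffun V -> 'I_c} -> R) (x y : {ffun V -> 'I_c}).
Implicit Types (e f : {set V}) (u v : V).

Let q : R := c%:R^-1.

Lemma eq_average F G : F =1 G -> average F = average G.
Proof. by move=> FG; congr (_ / _); apply: eq_bigr => x _. Qed.

Lemma averageD F G : average (fun x => F x + G x) = average F + average G.
Proof. by rewrite /average big_split/= mulrDl. Qed.

Lemma averageN F : average (fun x => - F x) = - average F.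
Proof. by rewrite /average sumrN mulNr. Qed.

Lemma averageB F G : average (fun x => F x - G x) = average F - average G.
Proof. by rewrite averageD averageN. Qed.

Lemma averageZ a F : average (fun x => a * F x) = a * average F.
Proof. by rewrite /average -mulr_sumr mulrA. Qed.

Lemma average_sum (I : Type) (r : seq I) (P : pred I)
    (F : I -> {ffun V -> 'I_c} -> R) :
  average (fun x => \sum_(i <- r | P i) F i x)
  = \sum_(i <- r | P i) average (F i).
Proof. by rewrite /average exchange_big/= -mulr_suml. Qed.

Lemma ler_average F G : (forall x, F x <= G x) -> average F <= average G.
Proof. by move=> FG; apply: ler_wpM2r; [rewrite invr_ge0 ler0n|exact: ler_sum]. Qed.

Lemma average_ge0 F : (forall x, 0 <= F x) -> 0 <= average F.
Proof. by move=> F0; apply: divr_ge0; [exact: sumr_ge0|exact: ler0n]. Qed.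

Lemma ler_norm_average F : `|average F| <= average (fun x => `|F x|).
Proof.
rewrite /average normrM (ger0_norm (x := _^-1)) ?invr_ge0 ?ler0n//.
by apply: ler_wpM2r; [rewrite invr_ge0 ler0n|exact: ler_norm_sum].
Qed.

Lemma average_cst (a : R) : average (fun _ : {ffun V -> 'I_c} => a) = a.
Proof.
rewrite /average sumr_const card_ffun card_ord -[a *+ _]mulr_natr mulfK//.
by rewrite pnatr_eq0 -lt0n expn_gt0 c_gt0.
Qed.

Lemma average_covariance F G a b : average F = a -> average G = b ->
  average (fun x => (F x - a) * (G x - b)) = average (fun x => F x * G x) - a * b.
Proof.
move=> Fa Gb; transitivity
    (average (fun x => F x * G x - b * F x - (a * G x - a * b))).
  by apply: eq_average => x; ring.
by rewrite !averageB !averageZ average_cst Fa Gb; ring.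
Qed.

Lemma monoP x e :
  reflect {in e &, forall v w, x v = x w} (mono x e).
Proof.
apply: (iffP forall_inP) => [h v w ve we|h v ve].
  by move/forall_inP: (h v ve) => /(_ w we); rewrite /color eqSS => /eqP/val_inj.
by apply/forall_inP => w we; rewrite /color (h v w).
Qed.

Lemma mono_recolor x e u : mono (recolor e u x) e.
Proof. by apply/monoP => v w ve we; rewrite !ffunE ve we. Qed.

Lemma recolor_eq_on x e u f : u \in e -> [disjoint f & e :\ u] ->
  {in f, recolor e u x =1 x}.
Proof.
move=> ue fe v vf; rewrite ffunE; case: ifPn => // ve.
have [->//|vu] := eqVneq v u.
by have := disjointFr fe vf; rewrite !inE vu ve.
Qed.

Lemma mono_recolor_disjoint x e u f : u \in e -> [disjoint f & e :\ u] ->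
  mono (recolor e u x) f = mono x f.
Proof.
move=> ue fe; apply/monoP/monoP => h v w vf wf; have := h v w vf wf;
  by rewrite !(recolor_eq_on x ue fe).
Qed.

Lemma mono_setU x e f : (0 < #|e :&: f|)%N ->
  mono x (e :|: f) = mono x e && mono x f.
Proof.
case/card_gt0P => z /setIP[ze zf]; apply/monoP/andP => [h|[/monoP he /monoP hf]].
  by split; apply/monoP => v w hv hw; apply: h; rewrite inE ?hv ?hw ?orbT.
move=> v w hv hw; suff H t : t \in e :|: f -> x t = x z by rewrite !H.
by case/setUP => ?; [exact: he|exact: hf].
Qed.

Lemma card_recolor_fiber e u y : u \in e ->
  #|[pred x | recolor e u x == y]|
  = (if mono y e then c ^ #|e|.-1 else 0)%N.
Proof.
move=> ue; case: ifPn => [/monoP me|nme]; last first.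
  apply: eq_card0 => x; rewrite !inE; apply/eqP => xy.
  by move: nme; rewrite -xy mono_recolor.
pose F v : pred 'I_c := if v \in e :\ u then predT else pred1 (y v).
rewrite (@eq_card _ _ (family F)); last first.
  move=> x; rewrite !inE; apply/eqP/familyP => [xy v|h].
    rewrite /F -xy; case: ifPn => // vN; rewrite inE.
    by rewrite (@recolor_eq_on _ _ _ [set v]) ?inE// disjoints1.
  have xu : x u = y u by apply/eqP; have := h u; rewrite /F !inE eqxx.
  apply/ffunP => v; rewrite ffunE; case: ifPn => ve.
    by rewrite xu; exact: me.
  by apply/eqP; have := h v; rewrite /F !inE (negPf ve) andbF /= inE eq_sym.
rewrite card_family foldrE big_image/=.
rewrite (bigID (mem (e :\ u)))/= [X in (_ * X)%N]big1 ?muln1; last first.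
  by move=> v vN; rewrite /F (negPf vN) card1.
rewrite (eq_bigr (fun=> c)); last by move=> v vN; rewrite /F vN card_ord.
rewrite prod_nat_const; congr (_ ^ _)%N.
by rewrite [in RHS](cardsD1 u) ue.
Qed.

Lemma card_gt0_mem u e : u \in e -> (0 < #|e|)%N.
Proof. by move=> ue; rewrite card_gt0; apply/set0Pn; exists u. Qed.

(** A coloring for which [e] is monochromatic arises by recoloring from exactly
    c ^ (|e| - 1) colorings, so the recolored uniform coloring is the uniform
    coloring conditioned on [e] being monochromatic. *)
Lemma average_mono_recolor e u G : u \in e ->
  average (fun x => (mono x e)%:R * G x)
  = q ^+ #|e|.-1 * average (G \o recolor e u).
Proof.
move=> ue; rewrite /average mulrA; congr (_ / _).
transitivity (q ^+ #|e|.-1 *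
    \sum_y \sum_(x | recolor e u x == y) G (recolor e u x)); last first.
  congr (_ * _); rewrite [RHS](partition_big (recolor e u) predT)//=.
rewrite mulr_sumr; apply: eq_bigr => y _.
rewrite (eq_bigr (fun=> G y)); last by move=> x /eqP ->.
rewrite sumr_const card_recolor_fiber//; case: ifPn => _; last first.
  by rewrite mulr0n mul0r mulr0.
rewrite mul1r -[G y *+ _]mulr_natl mulrA natrX -exprMn mulVf ?expr1n ?mul1r//.
by rewrite pnatr_eq0 -lt0n.
Qed.

Lemma average_mono e : (0 < #|e|)%N ->
  average (fun x => (mono x e)%:R : R) = q ^+ #|e|.-1.
Proof.
case/card_gt0P => u ue; transitivity (average (fun x => (mono x e)%:R * 1 : R)).
  by apply: eq_average => x; rewrite mulr1.
by rewrite (average_mono_recolor (fun=> 1) ue) average_cst mulr1.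
Qed.

(** Edges that meet are both monochromatic iff their union is. *)
Lemma average_mono2 e f : (0 < #|e :&: f|)%N ->
  average (fun x => (mono x e)%:R * (mono x f)%:R : R) = q ^+ #|e :|: f|.-1.
Proof.
move=> ef; rewrite -average_mono; last first.
  by have [z /setIP[ze _]] := card_gt0P ef; apply/card_gt0P; exists z; rewrite inE ze.
by apply: eq_average => x; rewrite mono_setU// -natrM mulnb.
Qed.

Lemma average_mono2_disjoint e f : (0 < #|e|)%N -> (0 < #|f|)%N -> [disjoint e & f] ->
  average (fun x => (mono x e)%:R * (mono x f)%:R : R)
  = q ^+ #|e|.-1 * q ^+ #|f|.-1.
Proof.
case/card_gt0P => u ue f0 ef; rewrite (average_mono_recolor _ ue) -(average_mono f0).
congr (_ * _); apply: eq_average => x /=; rewrite mono_recolor_disjoint//.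
by rewrite disjoint_sym (disjointWl (subD1set e u)).
Qed.

Lemma q_ge0 : 0 <= q. Proof. by rewrite invr_ge0. Qed.

Lemma q_le1 : q <= 1. Proof. by rewrite invf_le1 ?ltr0n// ler1n. Qed.

Lemma ler_exprq m n : (m <= n)%N -> q ^+ n <= q ^+ m.
Proof. by move=> mn; apply: ler_wiXn2l; rewrite ?q_ge0 ?q_le1. Qed.

(** A change requires [f] to be monochromatic before or after recoloring [e].
    Weighted by the probability of [e], the second event contributes the
    probability that [e] and [f] are both monochromatic, and the first the
    product of their probabilities, which is no larger as they meet. *)
Lemma average_recolor_change e f u : u \in e -> (0 < #|e :&: f|)%N ->
  q ^+ #|e|.-1 *
    average (fun x => `|(mono (recolor e u x) f)%:R - (mono x f)%:R|)
  <= 2 * q ^+ #|e :|: f|.-1.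
Proof.
move=> ue ef.
have [z /setIP[ze zf]] := card_gt0P ef.
have f0 : (0 < #|f|)%N by apply/card_gt0P; exists z.
apply: (@le_trans _ _ (q ^+ #|e|.-1 *
    (average (fun x => (mono (recolor e u x) f)%:R) +
     average (fun x => (mono x f)%:R)))).
  apply: ler_wpM2l; first by rewrite exprn_ge0 ?q_ge0.
  rewrite -averageD; apply: ler_average => x.
  by case: (mono _ f) (mono x f) => [] []; rewrite ?subrr ?subr0 ?sub0r
    ?normrN ?normr0 ?normr1 ?addr0 ?add0r// ?ler_wpDl.
rewrite mulrDr -(average_mono_recolor (fun x => (mono x f)%:R) ue) average_mono2//.
rewrite mulr_natl mulr2n lerD2l average_mono// -exprD ler_exprq//.
have := card_gt0_mem ze; have := card_gt0_mem zf.
have := cardsUI e f; move: ef; lia.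
Qed.

End Average.

(** * The error of the recoloring coupling *)

(** Probability that a nonempty [e] is monochromatic. *)
Definition edge_prob (R : realFieldType) (V : finType) (c : nat) (e : {set V}) : R :=
  c%:R^-1 ^+ #|e|.-1.

Definition edge_count (V : finType) (c : nat) (E : {set {set V}})
    (x : {ffun V -> 'I_c}) : nat :=
  (\sum_(e in E) mono x e)%N.

Definition joint (V : finType) (c : nat) (A B : {set {set V}}) (k l : nat)
    (x : {ffun V -> 'I_c}) : bool :=
  (edge_count A x == k) && (edge_count B x == l).

Definition mean (R : realFieldType) (V : finType) (c : nat)
    (E : {set {set V}}) : R :=
  \sum_(e in E) edge_prob R c e.

(** Expected number of pairs of distinct monochromatic edges, one in each family,
    that share at least two vertices. *)
Definition overlap (R : realFieldType) (V : finType) (c : nat)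
    (A B : {set {set V}}) : R :=
  \sum_(e in A) \sum_(f in B | (f != e) && (1 < #|e :&: f|)%N)
    edge_prob R c (e :|: f).

(** The expected number of monochromatic edges at [v]; the weights make edges of
    different sizes comparable. *)
Definition degree (R : realFieldType) (V : finType) (c : nat)
    (E : {set {set V}}) (v : V) : R :=
  \sum_(e in E | v \in e) edge_prob R c e.

Section RecoloringError.
Context (R : realFieldType) (V : finType) (c : nat).
Hypothesis c_gt0 : (0 < c)%N.
Implicit Types (e f : {set V}) (u v w : V) (A B E : {set {set V}}).
Implicit Types (x : {ffun V -> 'I_c}).

Let q : R := c%:R^-1.
Local Notation p := (edge_prob R c).

Lemma edge_prob_ge0 e : 0 <= p e.
Proof. by rewrite exprn_ge0// q_ge0. Qed.

Lemma edge_prob_le_q e : (1 < #|e|)%N -> p e <= q.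
Proof. by move=> e1; rewrite -[leRHS]expr1 ler_exprq//; lia. Qed.

Lemma edge_prob_setU1 e f : #|e :&: f| = 1%N -> p (e :|: f) = p e * p f.
Proof.
move=> ef; rewrite -exprD; congr (_ ^+ _).
have := cardsUI e f; have := subset_leq_card (subsetIl e f).
have := subset_leq_card (subsetIr e f); rewrite ef; lia.
Qed.

Lemma mean_ge0 E : 0 <= mean R c E.
Proof. by apply: sumr_ge0 => e _; exact: edge_prob_ge0. Qed.

Lemma degree_ge0 E v : 0 <= degree R c E v.
Proof. by apply: sumr_ge0 => e _; exact: edge_prob_ge0. Qed.

Lemma overlap_ge0 A B : 0 <= overlap R c A B.
Proof.
by apply: sumr_ge0 => e _; apply: sumr_ge0 => f _; exact: edge_prob_ge0.
Qed.

Lemma joint_recolor_stable A B E k l e u x : A \subset E -> B \subset E ->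
  e \in A -> e \notin B -> ~~ mono x e ->
  (forall f, f \in E -> f != e -> mono (recolor e u x) f = mono x f) ->
  joint A B k.+1 l (recolor e u x) = joint A B k l x.
Proof.
move=> AE BE eA eB xe same; rewrite /joint /edge_count.
rewrite (bigD1 e eA)/= [in RHS](bigD1 e eA)/= mono_recolor (negPf xe).
rewrite add0n add1n eqSS; congr (_ && _); congr (_ == _);
  apply: eq_bigr => f.
  by case/andP => fA fe; rewrite same// (fintype.subsetP AE).
by move=> fB; rewrite same ?(fintype.subsetP BE)//; apply: contraNneq eB => <-.
Qed.

(** If [e] is not monochromatic and recoloring [e] changes the status of no other
    edge, then exactly one monochromatic edge, [e] itself, is gained in [A]. *)
Lemma joint_recolor_change A B E k l e u x : A \subset E -> B \subset E ->
  e \in A -> e \notin B ->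
  `|(joint A B k.+1 l (recolor e u x))%:R - (joint A B k l x)%:R| <=
  (mono x e)%:R + \sum_(f in E | f != e)
    `|(mono (recolor e u x) f)%:R - (mono x f)%:R| :> R.
Proof.
move=> AE BE eA eB.
have le1 (a b : bool) : `|a%:R - b%:R| <= 1 :> R.
  by case: a b => [] []; rewrite ?subrr ?subr0 ?sub0r ?normrN ?normr0 ?normr1 ?ler01.
have [xe|xe] := boolP (mono x e).
  by apply: le_trans (le1 _ _) _; rewrite lerDl sumr_ge0.
have [/existsP[f /and3P[fE fe fx]]|/existsPn same] := boolP
    [exists f, [&& f \in E, f != e & mono (recolor e u x) f != mono x f]].
  apply: le_trans (le1 _ _) _; rewrite add0r (bigD1 f) ?fE//=.
  rewrite (_ : `|_| = 1) ?lerDl ?sumr_ge0//.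
  by move: fx; case: (mono _ f) (mono x f) => [] []//;
    rewrite ?subr0 ?sub0r ?normrN normr1.
rewrite (joint_recolor_stable _ _ AE BE)//; last first.
  by move=> f fE fe; have := same f; rewrite fE fe /= negbK => /eqP.
by rewrite subrr normr0 addr_ge0 ?sumr_ge0.
Qed.

(** The recoloring keeps the color of [u], so an edge meeting [e] only at [u] is
    unaffected.  The others either share two vertices with [e] or meet it in a
    single vertex v <> u, where independence gives p e * p f. *)
Lemma stein_edge A B E k l e u : A \subset E -> B \subset E ->
  e \in A -> e \notin B -> u \in e -> (1 < #|e|)%N ->
  `|average (fun x => (mono x e)%:R * (joint A B k.+1 l x)%:R)
    - p e * average (fun x => (joint A B k l x)%:R)| <=
  p e * q + 2 * (\sum_(f in E | (f != e) && (1 < #|e :&: f|)%N) p (e :|: f)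
    + p e * \sum_(v in e :\ u) degree R c E v).
Proof.
move=> AE BE eA eB ue e1.
rewrite (average_mono_recolor c_gt0 _ ue) -/q -mulrBr -averageB normrM.
rewrite (ger0_norm (edge_prob_ge0 e)).
apply: (@le_trans _ _ (p e * average (fun x => (mono x e)%:R +
  \sum_(f in E | f != e) `|(mono (recolor e u x) f)%:R - (mono x f)%:R|))).
  apply: ler_wpM2l; first exact: edge_prob_ge0.
  apply: le_trans (ler_norm_average _) _; apply: ler_average => x /=.
  exact: joint_recolor_change.
rewrite averageD mulrDr; apply: lerD.
  apply: ler_wpM2l; first exact: edge_prob_ge0.
  by rewrite average_mono//; [exact: edge_prob_le_q|exact: ltnW].
rewrite average_sum mulr_sumr.
apply: (@le_trans _ _ (2 * \sum_(f in E | f != e)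
   ((if (1 < #|e :&: f|)%N then p (e :|: f) else 0)
    + p e * \sum_(v in e :\ u) (if v \in f then p f else 0)))).
  rewrite mulr_sumr; apply: ler_sum => f /andP[fE fe].
  have S0 : 0 <= p e * \sum_(v in e :\ u) (if v \in f then p f else 0).
    rewrite mulr_ge0 ?edge_prob_ge0//; apply: sumr_ge0 => v _.
    by case: ifP => // _; exact: edge_prob_ge0.
  have [fe0|] := boolP [disjoint f & e :\ u].
    rewrite [X in average X](_ : _ = fun=> 0); last first.
      by apply/funext => x; rewrite mono_recolor_disjoint// subrr normr0.
    rewrite average_cst// mulr0 mulr_ge0// addr_ge0//.
    by case: ifP => // _; exact: edge_prob_ge0.
  case/pred0Pn => v /= /andP[vf veu].
  have [vu ve] : v != u /\ v \in e by move: veu; rewrite !inE => /andP.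
  have ef : (0 < #|e :&: f|)%N by apply/card_gt0P; exists v; rewrite inE ve.
  apply: le_trans (average_recolor_change _ c_gt0 ue ef) _.
  apply: ler_wpM2l => //; case: ltnP => ef1; first by rewrite lerDl.
  rewrite add0r [leLHS]edge_prob_setU1; last by apply/eqP; rewrite eqn_leq ef1.
  apply: ler_wpM2l; first exact: edge_prob_ge0.
  rewrite (bigD1 v)//= vf lerDl; apply: sumr_ge0 => w _.
  by case: ifP => // _; exact: edge_prob_ge0.
apply: ler_wpM2l => //; rewrite big_split/= -big_mkcondr/=.
apply: lerD.
  by rewrite le_eqVlt; apply/orP; left; apply/eqP; apply: eq_bigl => f; rewrite andbA.
rewrite -mulr_sumr; apply: ler_wpM2l; first exact: edge_prob_ge0.
rewrite exchange_big/=; apply: ler_sum => v _; rewrite -big_mkcondr/=.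
rewrite [leRHS](bigID (fun f => f != e))/=.
rewrite [X in _ <= X + _](eq_bigl
  (fun f => ((f \in E) && (f != e)) && (v \in f))); last first.
  by move=> f; rewrite andbAC.
by rewrite lerDl sumr_ge0// => f _; exact: edge_prob_ge0.
Qed.

End RecoloringError.

(** * Controlling the error through degrees and codegrees *)

Section DegreeBounds.
Context (R : realFieldType) (V : finType) (c : nat).
Hypothesis c_gt0 : (0 < c)%N.
Implicit Types (e f : {set V}) (u v w : V) (A B E : {set {set V}}).
Implicit Types (x : {ffun V -> 'I_c}).

Let q : R := c%:R^-1.
Local Notation p := (edge_prob R c).

Let q_ge0 : 0 <= q. Proof. exact: q_ge0. Qed.

(** Weighted number of edges containing both [v] and [w]. *)
Definition codegree E v w : R := \sum_(e in E | (v \in e) && (w \in e)) p e.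

Lemma sum_degree E r : (forall e, e \in E -> (#|e| <= r)%N) ->
  \sum_v degree R c E v <= r%:R * mean R c E.
Proof.
move=> Er; rewrite /degree; under eq_bigr do rewrite big_mkcondr/=.
rewrite exchange_big/= /mean mulr_sumr; apply: ler_sum => e eE.
rewrite -big_mkcond/= sumr_const -[_ *+ #|_|]mulr_natl ler_wpM2r ?edge_prob_ge0//.
by rewrite ler_nat Er.
Qed.

Lemma codegree_ge0 E v w : 0 <= codegree E v w.
Proof. by apply: sumr_ge0 => e _; exact: edge_prob_ge0. Qed.

(** Expanding the square gives pairs of edges through [v] and [w], hence sharing
    at least two vertices; for these p e * p f <= q * p (e U f). *)
Lemma codegree_sqr E v w : v != w ->
  codegree E v w ^+ 2 <= q * (overlap R c E E + mean R c E).
Proof.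
move=> vw; rewrite expr2 {1}/codegree mulr_suml mulrDr /overlap /mean !mulr_sumr.
rewrite -big_split/= big_mkcondr/=; apply: ler_sum => e eE.
have nonneg : 0 <= q * (\sum_(f in E | (f != e) && (1 < #|e :&: f|)%N) p (e :|: f)).
  by rewrite mulr_ge0// sumr_ge0// => f _; exact: edge_prob_ge0.
case: ifPn => [/andP[ve we]|_]; last first.
  by rewrite addr_ge0// mulr_ge0// edge_prob_ge0.
have vwI f : v \in f -> w \in f -> (1 < #|e :&: f|)%N.
  move=> vf wf; rewrite -[2%N]/(true.+1) -vw -cards2 subset_leq_card//.
  by apply/fintype.subsetP => z; rewrite !inE => /orP[] /eqP ->; rewrite ?ve ?we ?vf ?wf.
have key f : v \in f -> w \in f -> p e * p f <= q * p (e :|: f).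
  move=> vf wf; rewrite -exprD -exprS ler_exprq//.
  have := vwI f vf wf; have := cardsUI e f.
  have := subset_leq_card (subsetIl e f); have := subset_leq_card (subsetIr e f); lia.
rewrite /codegree mulr_sumr (bigD1 e) ?eE ?ve ?we//= addrC; apply: lerD; last first.
  by have := key e ve we; rewrite finset.setUid.
rewrite mulr_sumr [leRHS](bigID (fun f => (v \in f) && (w \in f)))/=.
rewrite [leRHS]addrC ler_wpDl//.
  by apply: sumr_ge0 => f _; rewrite mulr_ge0// edge_prob_ge0.
rewrite [leRHS](eq_bigl (fun f => (f \in E) && ((v \in f) && (w \in f)) && (f != e))).
  by apply: ler_sum => f /andP[/andP[_ /andP[vf wf]] _]; exact: key.
move=> f /=; case: (f \in E) (f != e) => [] []//=; rewrite ?andbF//.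
by case vf: (v \in f); case wf: (w \in f); rewrite ?andbF ?andbT// (vwI f vf wf).
Qed.

(** A threshold argument in one inequality: if [a] exceeds [eps] then so does [b],
    and b / eps >= 1. *)
Lemma min_le_eps (a b eps : R) : 0 <= a -> a <= b -> 0 < eps ->
  a <= eps + a * b / eps.
Proof.
move=> a0 ab e0; have [ae|/ltW ea] := leP a eps.
  by rewrite ler_wpDr// divr_ge0 ?mulr_ge0 ?(le_trans a0)// ltW.
apply: ler_wpDl; first exact: ltW.
by rewrite -mulrA ler_peMr// ler_pdivlMr// mul1r (le_trans ea).
Qed.

(** The sum over ordered pairs of distinct vertices of [e]; it is large only if
    [e] contains two vertices of large degree. *)
Definition pair_energy E e : R :=
  \sum_(v in e) \sum_(w in e | w != v) degree R c E v * degree R c E w.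

(** The root [u] is a vertex of maximal degree in [e], so that every other degree
    is the smaller of two and [min_le_eps] applies. *)
Lemma exists_root E e (eps : R) : (0 < #|e|)%N -> 0 < eps ->
  exists2 u, u \in e &
    \sum_(v in e :\ u) degree R c E v <= #|e|%:R * eps + pair_energy E e / eps.
Proof.
move=> /card_gt0P[v0 v0e] eps0.
pose u := [arg max_(u > v0 in e) degree R c E u]%O.
have [ue umax] : u \in e /\ forall v, v \in e -> degree R c E v <= degree R c E u.
  by rewrite /u; case: arg_maxP => // i ie h; split => // v ve; exact: h.
exists u => //.
apply: (@le_trans _ _ (\sum_(v in e :\ u)
    (eps + degree R c E v * degree R c E u / eps))).
  apply: ler_sum => v; rewrite !inE => /andP[_ ve].
  by apply: min_le_eps; rewrite ?degree_ge0//; exact: umax.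
rewrite big_split/=; apply: lerD.
  rewrite sumr_const -[eps *+ _]mulr_natl ler_wpM2r ?(ltW eps0)// ler_nat.
  by rewrite subset_leq_card// subD1set.
rewrite -mulr_suml ler_wpM2r ?invr_ge0 ?(ltW eps0)// /pair_energy.
rewrite [leRHS](bigID (fun v => v != u))/= ler_wpDr//.
  apply: sumr_ge0 => v _; apply: sumr_ge0 => w _.
  by rewrite mulr_ge0 ?degree_ge0.
rewrite [leRHS](eq_bigl (fun v => v \in e :\ u)); last first.
  by move=> v; rewrite !inE andbC.
apply: ler_sum => v; rewrite !inE => /andP[vu ve].
rewrite (bigD1 u)/=; last by rewrite ue eq_sym.
by rewrite lerDl sumr_ge0// => w _; rewrite mulr_ge0 ?degree_ge0.
Qed.

(** Exchanging sums weights each pair of vertices by its codegree, which is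
    uniformly small by [codegree_sqr]; the products of degrees add up to at
    most the square of the total degree.  The bound a <= eps^2 + a^2 / eps^2
    for the codegree avoids a square root. *)
Lemma sum_pair_energy E r (eps : R) : (forall e, e \in E -> (#|e| <= r)%N) -> 0 < eps ->
  \sum_(e in E) p e * (pair_energy E e / eps) <=
  (r%:R * mean R c E) ^+ 2 *
    (eps + q * (overlap R c E E + mean R c E) / eps ^+ 3).
Proof.
move=> Er eps0.
set K := eps + _.
have codeg_le v w : w != v -> codegree E v w / eps <= K.
  move=> wv; have := codegree_sqr E (v := v) (w := w); rewrite eq_sym => /(_ wv) h.
  have a0 := codegree_ge0 E v w.
  apply: (@le_trans _ _ (eps + codegree E v w ^+ 2 / eps ^+ 3)); last first.
    by rewrite lerD2l ler_wpM2r// invr_ge0 exprn_ge0// ltW.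
  have := @min_le_eps (codegree E v w / eps) (codegree E v w / eps) eps.
  rewrite divr_ge0 ?(ltW eps0)// => /(_ isT (lexx _) eps0).
  set a := codegree E v w.
  by rewrite (_ : a / eps * (a / eps) / eps = a ^+ 2 / eps ^+ 3)//; field; rewrite gt_eqF.
have -> : \sum_(e in E) p e * (pair_energy E e / eps) =
    \sum_v \sum_(w | w != v) degree R c E v * degree R c E w * (codegree E v w / eps).
  rewrite (eq_bigr (fun e => \sum_v \sum_(w | w != v)
      degree R c E v * degree R c E w *
        (if (v \in e) && (w \in e) then p e else 0) / eps)); last first.
    move=> e _; rewrite mulrA [p e * _]mulrC -mulrA mulr_suml big_mkcond/=.
    apply: eq_bigr => v _; case: ifPn => ve; last first.
      by rewrite big1// => w _; rewrite mulr0 mul0r.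
    rewrite mulr_suml big_mkcondl/=; apply: eq_bigr => w _.
    by case: ifP => we /=; rewrite ?mulr0 ?mul0r// !mulrA.
  rewrite exchange_big/=; apply: eq_bigr => v _.
  rewrite exchange_big/=; apply: eq_bigr => w _.
  rewrite /codegree big_mkcondr/= [X in _ = _ * X]mulr_suml [RHS]mulr_sumr.
  by apply: eq_bigr => e _; rewrite !mulrA.
apply: (@le_trans _ _ (\sum_v \sum_w degree R c E v * degree R c E w * K)).
  apply: ler_sum => v _; rewrite [leRHS](bigID (fun w => w != v))/= ler_wpDr//.
    apply: sumr_ge0 => w _; rewrite !mulr_ge0 ?degree_ge0//.
    by rewrite addr_ge0 ?(ltW eps0)// divr_ge0 ?exprn_ge0 ?(ltW eps0)//
      mulr_ge0// addr_ge0 ?overlap_ge0 ?mean_ge0.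
  by apply: ler_sum => w wv; rewrite ler_wpM2l ?mulr_ge0 ?degree_ge0// codeg_le.
rewrite (_ : \sum_v _ = (\sum_v degree R c E v) ^+ 2 * K); last first.
  rewrite expr2 !mulr_suml; apply: eq_bigr => v _.
  by rewrite mulr_sumr mulr_suml.
apply: ler_wpM2r.
  by rewrite addr_ge0 ?(ltW eps0)// divr_ge0 ?exprn_ge0 ?(ltW eps0)//
      mulr_ge0// addr_ge0 ?overlap_ge0 ?mean_ge0.
rewrite lerXn2r ?nnegrE ?sum_degree//.
  by apply: sumr_ge0 => v _; exact: degree_ge0.
by rewrite mulr_ge0 ?mean_ge0.
Qed.

(** Approximate form of the identity E[N g(N)] = E[N] E[g(N + 1)] that
    characterizes the Poisson law, for [g] the indicator of [k.+1]. *)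
Lemma stein_identity A B E r k l (eps : R) : A \subset E -> B \subset E ->
  [disjoint A & B] -> (forall e, e \in E -> (1 < #|e| <= r)%N) -> 0 < eps ->
  `|k.+1%:R * average (fun x => (joint A B k.+1 l x)%:R)
    - mean R c A * average (fun x => (joint A B k l x)%:R)| <=
  q * mean R c E + 2 * (overlap R c E E + r%:R * eps * mean R c E +
    (r%:R * mean R c E) ^+ 2 *
    (eps + q * (overlap R c E E + mean R c E) / eps ^+ 3)).
Proof.
move=> AE BE AB Er eps0.
have -> : k.+1%:R * average (fun x => (joint A B k.+1 l x)%:R) =
    \sum_(e in A) average (fun x => (mono x e)%:R * (joint A B k.+1 l x)%:R) :> R.
  rewrite -averageZ -average_sum; apply: eq_average => x.
  rewrite -mulr_suml; case jx: (joint _ _ _ _ _); rewrite ?mulr0// !mulr1.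
  by move: jx => /andP[/eqP <- _]; rewrite /edge_count natr_sum.
rewrite [X in _ - X]mulr_suml -sumrB.
apply: le_trans (ler_norm_sum _ _ _) _.
apply: (@le_trans _ _ (\sum_(e in A) (p e * q + 2 *
    (\sum_(f in E | (f != e) && (1 < #|e :&: f|)%N) p (e :|: f)
    + (r%:R * eps * p e + p e * (pair_energy E e / eps)))))).
  apply: ler_sum => e eA; have eE := fintype.subsetP AE e eA.
  have /andP[e1 er] := Er e eE.
  have [u ue hu] := @exists_root E e eps (ltnW e1) eps0.
  have eB : e \notin B by rewrite (disjointFr AB).
  apply: le_trans (stein_edge R c_gt0 k l AE BE eA eB ue e1) _.
  rewrite lerD2l ler_wpM2l// lerD2l [r%:R * eps * p e]mulrC -mulrDr.
  apply: ler_wpM2l; first exact: edge_prob_ge0.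
  apply: le_trans hu _; rewrite lerD2r; apply: ler_wpM2r; first exact: ltW.
  by rewrite ler_nat.
have pe0 e : 0 <= pair_energy E e / eps.
  rewrite divr_ge0 ?(ltW eps0)//; apply: sumr_ge0 => v _; apply: sumr_ge0 => w _.
  by rewrite mulr_ge0 ?degree_ge0.
apply: (@le_trans _ _ (\sum_(e in E) (p e * q + 2 *
    (\sum_(f in E | (f != e) && (1 < #|e :&: f|)%N) p (e :|: f)
    + (r%:R * eps * p e + p e * (pair_energy E e / eps)))))).
  rewrite [leRHS](big_setID A)/= (finset.setIidPr AE) lerDl; apply: sumr_ge0 => e _.
  rewrite addr_ge0 ?mulr_ge0 ?edge_prob_ge0// addr_ge0//.
    by apply: sumr_ge0 => f _; exact: edge_prob_ge0.
  apply: addr_ge0; last by rewrite mulr_ge0 ?edge_prob_ge0.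
  by rewrite !mulr_ge0 ?edge_prob_ge0 ?(ltW eps0).
rewrite big_split/= -mulr_suml mulrC lerD2l -mulr_sumr ler_wpM2l//.
rewrite big_split/= -addrA lerD2l big_split/= -mulr_sumr lerD2l.
by apply: sum_pair_energy => // e /Er /andP[].
Qed.

End DegreeBounds.

(** * Overlapping pairs and the variance *)

Section Overlap.
Context (R : realFieldType) (V : finType) (c : nat).
Hypothesis c_gt0 : (0 < c)%N.
Implicit Types (e f S : {set V}) (u v w : V) (A B E : {set {set V}}).
Implicit Types (x : {ffun V -> 'I_c}).

Let q : R := c%:R^-1.
Local Notation p := (edge_prob R c).
Local Notation "'cpow' S" := (c%:R ^+ #|S|.-1 : R) (at level 10).

Let q_ge0 : 0 <= q. Proof. exact: q_ge0. Qed.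

Lemma average_edge_count E : (forall e, e \in E -> (0 < #|e|)%N) ->
  average (fun x => (edge_count E x)%:R) = mean R c E.
Proof.
move=> E0; rewrite /mean.
under eq_average do rewrite natr_sum.
by rewrite average_sum; apply: eq_bigr => e /E0 e0; rewrite average_mono.
Qed.

(** Two edges sharing at most one vertex are uncorrelated; if they share more,
    p e * p f <= q * p (e U f), so that the covariance is at least
    (1 - q) * p (e U f). *)
Lemma covariance_mono_ge e f : (1 < #|e|)%N -> (1 < #|f|)%N ->
  (1 - q) * ((if f == e then p e else 0) +
    (if (f != e) && (1 < #|e :&: f|)%N then p (e :|: f) else 0)) <=
  average (fun x => (mono x e)%:R * (mono x f)%:R) - p e * p f.
Proof.
move=> e1 f1; have [->|fe] := eqVneq f e.
  rewrite addr0 average_mono2// ?finset.setUid ?finset.setIid ?(ltnW e1)//.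
  rewrite mulrBl mul1r -/(p e) lerD2l lerN2 ler_wpM2r ?edge_prob_ge0//.
  exact: edge_prob_le_q.
rewrite add0r /=; case: ltnP => ef1.
  rewrite average_mono2// 1?ltnW// -/(p _) mulrBl mul1r lerD2l lerN2.
  rewrite -exprD -exprS ler_exprq//.
  have := subset_leq_card (finset.subsetIl e f).
  have := cardsUI e f; have := subset_leq_card (finset.subsetIr e f); lia.
rewrite mulr0; have [ef0|/card_gt0P[z zef]] := posnP #|e :&: f|.
  rewrite average_mono2_disjoint ?(ltnW e1) ?(ltnW f1) ?subrr//.
  by rewrite -setI_eq0 -cards_eq0 ef0.
have ef : #|e :&: f| = 1%N by apply/eqP; rewrite eqn_leq ef1; apply/card_gt0P; exists z.
by rewrite average_mono2 ?ef// -/(p _) edge_prob_setU1// subrr.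
Qed.

(** The mean is the contribution of the diagonal pairs to the variance and the
    overlap that of the distinct pairs, up to the factor 1 - q. *)
Lemma overlap_le_variance E : (forall e, e \in E -> (1 < #|e|)%N) ->
  (1 - q) * (mean R c E + overlap R c E E) <=
  average (fun x => ((edge_count E x)%:R - mean R c E) ^+ 2).
Proof.
move=> E1.
rewrite [leRHS](_ : _ = \sum_(e in E) \sum_(f in E)
    (average (fun x => (mono x e)%:R * (mono x f)%:R) - p e * p f)); last first.
  transitivity (average (fun x => \sum_(e in E) \sum_(f in E)
      ((mono x e)%:R - p e) * ((mono x f)%:R - p f) : R)).
    apply: eq_average => x; rewrite /edge_count natr_sum /mean -sumrB expr2 mulr_suml.
    by apply: eq_bigr => e _; rewrite mulr_sumr.
  rewrite average_sum; apply: eq_bigr => e eE.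
  rewrite average_sum; apply: eq_bigr => f fE.
  by apply: average_covariance => //; rewrite average_mono// ltnW// E1.
rewrite /mean /overlap -big_split mulr_sumr/=; apply: ler_sum => e eE.
have pe : p e = \sum_(f in E) if f == e then p e else 0.
  rewrite -big_mkcondr (big_pred1 e)// => f /=.
  by case: eqP => [->|]; rewrite ?eE ?andbF.
rewrite {1}pe big_mkcondr/= -big_split mulr_sumr/=; apply: ler_sum => f fE.
by apply: covariance_mono_ge; exact: E1.
Qed.

Lemma sum_setU_disjoint A B (F : {set V} -> R) : [disjoint A & B] ->
  \sum_(e in A :|: B) F e = \sum_(e in A) F e + \sum_(e in B) F e.
Proof.
by move=> AB; rewrite -bigU//; apply: eq_bigl => e; rewrite !inE.
Qed.

Lemma overlap_setU A B : [disjoint A & B] ->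
  overlap R c (A :|: B) (A :|: B)
  = overlap R c A A + overlap R c B B + 2 * overlap R c A B.
Proof.
move=> AB.
have BA : overlap R c B A = overlap R c A B.
  rewrite /overlap; under eq_bigr do rewrite big_mkcondr/=.
  rewrite exchange_big/=; apply: eq_bigr => e eA; rewrite [RHS]big_mkcondr/=.
  by apply: eq_bigr => f fB; rewrite eq_sym finset.setIC finset.setUC.
have split e : \sum_(f in A :|: B | (f != e) && (1 < #|e :&: f|)%N) p (e :|: f) =
    \sum_(f in A | (f != e) && (1 < #|e :&: f|)%N) p (e :|: f) +
    \sum_(f in B | (f != e) && (1 < #|e :&: f|)%N) p (e :|: f).
  rewrite big_mkcondr/= [X in _ = X + _]big_mkcondr [X in _ = _ + X]big_mkcondr/=.
  by rewrite sum_setU_disjoint.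
rewrite {1}/overlap.
under eq_bigr do rewrite split//.
rewrite sum_setU_disjoint// !big_split/= -/(overlap R c A A) -/(overlap R c A B).
by rewrite -/(overlap R c B A) -/(overlap R c B B) BA; ring.
Qed.

Lemma mean_setU A B : [disjoint A & B] ->
  mean R c (A :|: B) = mean R c A + mean R c B.
Proof. by move=> AB; exact: sum_setU_disjoint. Qed.

(** The codegree of an arbitrary set of vertices. *)
Definition set_degree A S : R := \sum_(e in A | S \subset e) p e.

Lemma cpow_edge_prob m n : (m <= n)%N -> c%:R ^+ m * q ^+ n = q ^+ (n - m) :> R.
Proof.
move=> mn; rewrite -{1}(subnK mn) exprD mulrCA -exprMn mulfV ?expr1n ?mulr1//.
by rewrite pnatr_eq0 -lt0n.
Qed.

Lemma cpow_prob_le S e f : (0 < #|S|)%N -> S \subset e :&: f ->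
  cpow S * (p e * p f) <= p (e :|: f).
Proof.
move=> S0 Sef; rewrite -exprD.
have := subset_leq_card Sef; have := cardsUI e f.
have := subset_leq_card (finset.subsetIl e f); have := subset_leq_card (finset.subsetIr e f).
by move=> ? ? ? ?; rewrite cpow_edge_prob ?ler_exprq//; lia.
Qed.

Lemma prob_setU_eq_cpow e f : (0 < #|e :&: f|)%N ->
  p (e :|: f) = cpow (e :&: f) * (p e * p f).
Proof.
move=> ef; rewrite -exprD.
have := cardsUI e f; move: ef.
have := subset_leq_card (finset.subsetIl e f); have := subset_leq_card (finset.subsetIr e f).
by move=> ? ? ? ?; rewrite cpow_edge_prob; [congr (_ ^+ _)|]; lia.
Qed.

Lemma set_degreeM A B S : set_degree A S * set_degree B S =
  \sum_(e in A) \sum_(f in B) if S \subset e :&: f then p e * p f else 0.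
Proof.
rewrite /set_degree mulr_suml big_mkcondr/=; apply: eq_bigr => e eA.
case: ifPn => Se; last first.
  by rewrite big1// => f _; rewrite finset.subsetI (negPf Se).
rewrite mulr_sumr big_mkcondr/=; apply: eq_bigr => f fB.
by rewrite finset.subsetI Se.
Qed.

(** A pair of edges is counted at S = e :&: f, where
    p (e U f) = c ^ (|S| - 1) * p e * p f. *)
Lemma overlap_le_sum_sets A B t : (forall e, e \in A -> (#|e| <= t)%N) ->
  overlap R c A B <= \sum_(S : {set V} | (1 < #|S| <= t)%N)
    cpow S * (set_degree A S * set_degree B S).
Proof.
move=> At.
under [leRHS]eq_bigr do rewrite set_degreeM mulr_sumr.
rewrite exchange_big/=; apply: ler_sum => e eA.
under [leRHS]eq_bigr do rewrite mulr_sumr.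
rewrite exchange_big/= big_mkcondr; apply: ler_sum => f fB.
have nonneg S : 0 <= cpow S * (if S \subset e :&: f then p e * p f else 0).
  by rewrite mulr_ge0 ?exprn_ge0//; case: ifP => // _; rewrite mulr_ge0 ?edge_prob_ge0.
case: ifPn => [/andP[_ ef]|_]; last exact: sumr_ge0.
rewrite (bigD1 (e :&: f))/=; last first.
  by rewrite ef (leq_trans _ (At e eA))// subset_leq_card// subsetIl.
by rewrite subxx -prob_setU_eq_cpow ?(ltnW ef)// lerDl sumr_ge0.
Qed.

(** The square counts pairs of edges containing S; distinct ones give the overlap
    of [A], each at most 2 ^ r times since S is contained in an edge of size
    at most [r].  The diagonal pairs are controlled by [kappa], which is taken
    to be 1 in general and q when [t] is smaller than all edge sizes. *)
Lemma sum_set_degree_sqr A r t kappa : 0 <= kappa ->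
  (forall e, e \in A -> (#|e| <= r)%N) ->
  (forall e S, e \in A -> S \subset e -> (1 < #|S| <= t)%N ->
     cpow S * p e <= kappa) ->
  \sum_(S : {set V} | (1 < #|S| <= t)%N) cpow S * set_degree A S ^+ 2 <=
  2 ^+ r * (overlap R c A A + kappa * mean R c A).
Proof.
move=> k0 Ar Ak.
have nsub e (eA : e \in A) : #|[set S : {set V} | S \subset e]|%:R <= 2 ^+ r :> R.
  by rewrite -/(powerset e) card_powerset natrX ler_weXn2l ?ler1n ?Ar.
under [leLHS]eq_bigr do rewrite expr2 set_degreeM mulr_sumr.
rewrite exchange_big/= /overlap /mean [kappa * _]mulr_sumr -big_split/= mulr_sumr.
apply: ler_sum => e eA.
under [leLHS]eq_bigr do rewrite mulr_sumr.
rewrite exchange_big/= (bigD1 e)//= addrC [leRHS]mulrDr; apply: lerD; last first.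
  apply: (@le_trans _ _ (\sum_(S in [set S : {set V} | S \subset e]) kappa * p e)).
    rewrite big_mkcond [leRHS]big_mkcond/=; apply: ler_sum => S _.
    rewrite inE finset.setIid; case: (boolP (S \subset e)) => Se; last by rewrite mulr0 if_same.
    case: ifPn => St; last by rewrite mulr_ge0 ?edge_prob_ge0.
    by rewrite mulrA ler_wpM2r ?edge_prob_ge0 ?Ak.
  rewrite sumr_const -[_ *+ #|pred_of_set _|]mulr_natl ler_wpM2r ?nsub//.
  by rewrite mulr_ge0 ?edge_prob_ge0.
rewrite [X in 2 ^+ r * X](eq_bigl (fun f => ((f \in A) && (f != e)) && (1 < #|e :&: f|)%N));
  last by move=> f; rewrite andbA.
rewrite [leRHS]mulr_sumr [leRHS]big_mkcondr/=; apply: ler_sum => f /andP[fA fe].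
have [ef|ef] := ltnP 1 #|e :&: f|; last first.
  rewrite big1// => S /andP[S1 _]; case: ifPn => [Sef|_]; last by rewrite mulr0.
  by have := leq_trans S1 (leq_trans (subset_leq_card Sef) ef); rewrite ltnn.
apply: (@le_trans _ _ (\sum_(S in [set S : {set V} | S \subset e]) p (e :|: f))).
  rewrite big_mkcond [leRHS]big_mkcond/=; apply: ler_sum => S _.
  rewrite inE; case: (boolP (S \subset e :&: f)) => Sef; last first.
    by rewrite mulr0 if_same; case: ifP => // _; exact: edge_prob_ge0.
  rewrite (fintype.subset_trans Sef (finset.subsetIl _ _)).
  case: ifPn => [/andP[S1 _]|_]; last exact: edge_prob_ge0.
  by apply: cpow_prob_le; rewrite ?(ltnW S1).
rewrite sumr_const -[_ *+ #|pred_of_set _|]mulr_natl ler_wpM2r ?nsub//.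
exact: edge_prob_ge0.
Qed.

(** The weighted inequality a b <= delta a^2 + b^2 / delta separates the layers.
    Only subsets of size at most [r] matter, and since [r < s] the diagonal
    term of the second layer gains a factor q. *)
Lemma cross_overlap A B r s (delta : R) : (r < s)%N -> 0 < delta ->
  (forall e, e \in A -> #|e| = r) -> (forall f, f \in B -> #|f| = s) ->
  overlap R c A B <=
  delta * (2 ^+ r * (overlap R c A A + mean R c A)) +
  delta^-1 * (2 ^+ s * (overlap R c B B + q * mean R c B)).
Proof.
move=> rs d0 Ar Bs.
have Ar' e : e \in A -> (#|e| <= r)%N by move=> /Ar ->.
have Bs' f : f \in B -> (#|f| <= s)%N by move=> /Bs ->.
apply: le_trans (overlap_le_sum_sets B Ar') _.
have hA := @sum_set_degree_sqr A r r 1 ler01 Ar'.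
have hB := @sum_set_degree_sqr B s r q q_ge0 Bs'.
apply: (@le_trans _ _ (\sum_(S : {set V} | (1 < #|S| <= r)%N)
   (delta * (cpow S * set_degree A S ^+ 2) +
    delta^-1 * (cpow S * set_degree B S ^+ 2)))).
  apply: ler_sum => S _.
  have -> : delta * (cpow S * set_degree A S ^+ 2) +
      delta^-1 * (cpow S * set_degree B S ^+ 2) =
      cpow S * (delta * set_degree A S ^+ 2 + delta^-1 * set_degree B S ^+ 2).
    by ring.
  rewrite ler_wpM2l ?exprn_ge0//.
  set a := set_degree A S; set b := set_degree B S.
  rewrite -subr_ge0 (_ : _ - _ = (delta * a ^+ 2 + delta * (a - delta^-1 * b) ^+ 2
     + delta^-1 * b ^+ 2) / 2); last by field; rewrite gt_eqF.
  by rewrite divr_ge0// !addr_ge0// mulr_ge0 ?sqr_ge0 ?invr_ge0 ?ltW.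
rewrite big_split/= -!mulr_sumr; apply: lerD.
  rewrite ler_wpM2l ?(ltW d0)// -[mean R c A]mul1r; apply: hA => e S eA Se /andP[S1 Sr].
  have := subset_leq_card Se; rewrite (Ar e eA) => ?.
  by rewrite cpow_edge_prob ?(Ar e eA) ?exprn_ile1 ?q_le1//; lia.
rewrite ler_wpM2l ?invr_ge0 ?(ltW d0)//; apply: hB => f S fB Sf /andP[S1 Sr].
rewrite cpow_edge_prob ?(Bs f fB); last lia.
by rewrite -[leRHS]expr1 ler_exprq//; lia.
Qed.

End Overlap.

Local Open Scope classical_set_scope.

(** * A two-index recurrence that forces Poisson limits *)

Definition poisson_weight (R : realType) (lambda : R) (k : nat) : R :=
  expR (- lambda) * (lambda ^+ k / k`!%:R).

Section Recurrence.
Context (R : realType).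
Implicit Types (u : nat -> R).

Lemma cvg0_bounded_mul u (v : nat -> R) : u @ \oo --> 0 ->
  (\forall n \near \oo, `|v n| <= 1) -> (u n * v n) @[n --> \oo] --> 0.
Proof.
move=> u0 v1; apply/cvgr0Pnorm_le => e e0.
near=> n; rewrite normrM -[leRHS]mulr1; apply: ler_pM => //.
  by near: n; move/cvgr0Pnorm_le : u0; exact.
by near: n.
Unshelve. all: by end_near. Qed.

Lemma cvg_sumr (I : Type) (s : seq I) (u : I -> nat -> R) (a : I -> R) :
  (forall i, u i @ \oo --> a i) ->
  (\sum_(i <- s) u i n) @[n --> \oo] --> \sum_(i <- s) a i.
Proof.
move=> ua; elim: s => [|i s IH].
  by rewrite big_nil; under eq_fun do rewrite big_nil; exact: cvg_cst.
rewrite big_cons; under eq_fun do rewrite big_cons.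
by apply: cvgD => //; exact: ua.
Qed.

(** [z] stands for the probability of the origin: the recurrence determines every
    probability as a multiple of it. *)
Lemma cvg_recurrence_ratio (pmf : nat -> nat -> R) (m z : nat -> R) (lambda b : R) :
  m @ \oo --> lambda ->
  (forall k, \forall n \near \oo, `|pmf n k| <= 1) ->
  (forall k, (k.+1%:R * pmf n k.+1 - m n * pmf n k) @[n --> \oo] --> 0) ->
  (pmf n 0%N - b * z n) @[n --> \oo] --> 0 ->
  forall k, (pmf n k - lambda ^+ k / k`!%:R * b * z n) @[n --> \oo] --> 0.
Proof.
move=> ml pmf_le1 rec base; elim=> [|k IH].
  by rewrite expr0 fact0 invr1 !mul1r.
have ml0 : (m n - lambda) @[n --> \oo] --> 0.
  by rewrite -(subrr lambda); exact: cvgB ml (cvg_cst _).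
have : k.+1%:R^-1 * ((k.+1%:R * pmf n k.+1 - m n * pmf n k) +
    (m n - lambda) * pmf n k + lambda * (pmf n k - lambda ^+ k / k`!%:R * b * z n))
    @[n --> \oo] --> k.+1%:R^-1 * (0 + 0 + lambda * 0).
  apply: cvgM; first exact: cvg_cst.
  apply: cvgD; last by apply: cvgM IH; exact: cvg_cst.
  by apply: cvgD; [exact: rec|exact: cvg0_bounded_mul].
rewrite !(addr0, mulr0).
apply: cvg_trans; apply: near_eq_cvg; near=> n => /=.
have k0 : k.+1%:R != 0 :> R by rewrite pnatr_eq0.
have kf0 : k`!%:R != 0 :> R by rewrite pnatr_eq0 -lt0n fact_gt0.
by rewrite exprS factS natrM; field; rewrite kf0 addrC natr1 k0.
Unshelve. all: by end_near. Qed.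

Lemma cvg_exp_partial_sum (lambda : R) :
  (\sum_(k < K) lambda ^+ k / k`!%:R) @[K --> \oo] --> expR lambda.
Proof.
have := is_cvg_series_exp_coeff lambda; rewrite /series /exp_coeff/= => h.
under eq_fun do rewrite -(big_mkord xpredT (fun k => lambda ^+ k / k`!%:R)).
exact: h.
Qed.

(** Both recurrences express every probability through that of the origin; as the
    mass of large boxes is close to 1, uniformly in n, and the Poisson weights
    sum to 1, the probability of the origin tends to
    expR (- (lambda1 + lambda2)). *)
Lemma cvg_poisson_recurrence (pmf : nat -> nat -> nat -> R) (m1 m2 : nat -> R)
    (lambda1 lambda2 : R) :
  m1 @ \oo --> lambda1 -> m2 @ \oo --> lambda2 ->
  (forall n k l, 0 <= pmf n k l) ->
  (forall k l, (k.+1%:R * pmf n k.+1 l - m1 n * pmf n k l) @[n --> \oo] --> 0) ->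
  (forall k l, (l.+1%:R * pmf n k l.+1 - m2 n * pmf n k l) @[n --> \oo] --> 0) ->
  (forall K, \forall n \near \oo,
    1 - (m1 n + m2 n) / K.+1%:R <= \sum_(k < K.+1) \sum_(l < K.+1) pmf n k l <= 1) ->
  forall k l, pmf n k l @[n --> \oo] -->
    poisson_weight lambda1 k * poisson_weight lambda2 l.
Proof.
move=> m1l m2l pmf_ge0 rec1 rec2 mass.
have pmf_le1 k l : \forall n \near \oo, `|pmf n k l| <= 1.
  pose K := maxn k l.
  have kK : (k < K.+1)%N by rewrite ltnS leq_maxl.
  have lK : (l < K.+1)%N by rewrite ltnS leq_maxr.
  near=> n; rewrite ger0_norm//.
  have /andP[_] : 1 - (m1 n + m2 n) / K.+1%:R <=
    \sum_(k < K.+1) \sum_(l < K.+1) pmf n k l <= 1 by near: n; exact: mass.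
  apply: le_trans; rewrite (bigD1 (Ordinal kK))//= (bigD1 (Ordinal lK))//=.
  by rewrite -addrA lerDl addr_ge0// ?sumr_ge0// => i _; rewrite sumr_ge0.
pose z n := pmf n 0%N 0%N.
pose a k : R := lambda1 ^+ k / k`!%:R; pose b l : R := lambda2 ^+ l / l`!%:R.
have ratio k l : (pmf n k l - a k * b l * z n) @[n --> \oo] --> 0.
  apply: (cvg_recurrence_ratio (pmf := fun n k => pmf n k l) m1l) => //.
  have base : (pmf n 0%N 0%N - 1 * z n) @[n --> \oo] --> 0.
    by under eq_fun do rewrite mul1r subrr; exact: cvg_cst.
  have := cvg_recurrence_ratio (pmf := fun n l => pmf n 0%N l) m2l (pmf_le1 0%N)
    (rec2 0%N) base l.
  by under eq_fun do rewrite mulr1.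
pose SA K := \sum_(k < K) a k; pose SB K := \sum_(l < K) b l.
pose L := expR lambda1 * expR lambda2.
have SL : (SA K * SB K) @[K --> \oo] --> L.
  by apply: cvgM; exact: cvg_exp_partial_sum.
have box K :
    (\sum_(k < K) \sum_(l < K) pmf n k l - SA K * SB K * z n) @[n --> \oo] --> 0.
  rewrite [X in X @ _](_ : _ = (fun n => \sum_(k < K) \sum_(l < K)
      (pmf n k l - a k * b l * z n))).
    have : (\sum_(k < K) \sum_(l < K) (pmf n k l - a k * b l * z n)) @[n --> \oo] -->
        \sum_(k < K) \sum_(l < K) (0 : R).
      by apply: cvg_sumr => k; exact: cvg_sumr.
    by under eq_bigr do rewrite big1_eq; rewrite big1_eq.
  apply/funext => n; under [RHS]eq_bigr do rewrite sumrB.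
  rewrite sumrB; congr (_ - _); rewrite /SA /SB !mulr_suml; apply: eq_bigr => k _.
  by rewrite mulr_sumr mulr_suml.
(* the mass of a large box, compared for [pmf n] and for the limit *)
have zL : (L * z n) @[n --> \oo] --> (1 : R).
  apply/cvgrPdist_le => e e0; pose e4 := e / 4.
  have e40 : 0 < e4 by rewrite divr_gt0.
  pose M := lambda1 + lambda2 + 1.
  have [K [KL KM]] : exists K, `|L - SA K.+1 * SB K.+1| <= e4 /\ `|M| / K.+1%:R <= e4.
    suff : \forall K \near \oo, `|L - SA K.+1 * SB K.+1| <= e4 /\ `|M| / K.+1%:R <= e4.
      by case=> K0 _ /(_ K0 (leqnn _)); exists K0.
    near=> K; split; near: K.
      have /cvgrPdist_le/(_ e4 e40) := SL.
      by move=> [N _ NS]; exists N => // K /= NK; apply: NS => /=; exact: leqW.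
    exists (Num.truncn (`|M| / e4)) => // K /= MK.
    rewrite ler_pdivrMr ?ltr0n// mulrC -ler_pdivrMr//.
    apply: ltW; apply: lt_le_trans (truncnS_gt _) _.
    by rewrite ler_nat.
  near=> n.
  have z1 : `|z n| <= 1 by near: n; exact: pmf_le1.
  have bx : `|\sum_(k < K.+1) \sum_(l < K.+1) pmf n k l - SA K.+1 * SB K.+1 * z n| <= e4.
    by near: n; have /cvgr0Pnorm_le := box K.+1; exact.
  have /andP[ms1 ms2] : 1 - (m1 n + m2 n) / K.+1%:R <=
    \sum_(k < K.+1) \sum_(l < K.+1) pmf n k l <= 1 by near: n; exact: mass.
  have mM : m1 n + m2 n <= M.
    near: n; apply: cvgr_le; first exact: cvgD m1l m2l.
    by rewrite /M ltrDl.
  have mK : (m1 n + m2 n) / K.+1%:R <= e4.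
    apply: le_trans KM; rewrite ler_wpM2r ?invr_ge0//.
    by apply: le_trans mM _; exact: ler_norm.
  set S := \sum_(k < _) _ in bx ms1 ms2; set T := SA K.+1 * SB K.+1 in bx KL.
  have LT : `|(L - T) * z n| <= e4.
    by rewrite normrM -[leRHS]mulr1 ler_pM.
  have -> : 1 - L * z n = (1 - S) + (S - T * z n) - (L - T) * z n by ring.
  apply: le_trans (ler_normB _ _) _; apply: le_trans (lerD (ler_normD _ _) (lexx _)) _.
  rewrite (ger0_norm (x := 1 - S)) ?subr_ge0//.
  have : 1 - S <= e4 by apply: le_trans mK; rewrite lerBlDl -lerBlDr.
  by rewrite /e4 in bx LT *; lra.
move=> k l.
have L0 : L != 0 by rewrite mulf_neq0// gt_eqF ?expR_gt0.
have : (pmf n k l - a k * b l * z n) + a k * b l / L * (L * z n)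
    @[n --> \oo] --> 0 + a k * b l / L * 1.
  by apply: cvgD; [exact: ratio|apply: cvgM zL; exact: cvg_cst].
have <- : 0 + a k * b l / L * 1 = poisson_weight lambda1 k * poisson_weight lambda2 l.
  rewrite /poisson_weight !expRN -/(a k) -/(b l) /L; field.
  by rewrite !gt_eqF ?expR_gt0.
apply: cvg_trans; apply: near_eq_cvg; near=> n => /=.
by field.
Unshelve. all: by end_near. Qed.

End Recurrence.

(** * From colorings on a probability space to averages *)

Section FiniteSplit.
Context d (Omega : measurableType d) (R : realType) (P : probability Omega R).

(** Integral of a function that is constant on each of finitely many disjoint
    events, the rest of the space being kept as a remainder. *)
Lemma integral_split_atoms (I : eqType) (s : seq I) (F : I -> set Omega)
    (a : I -> R) (g : Omega -> R) :
  measurable_fun [set: Omega] g -> uniq s ->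
  (forall i, measurable (F i)) -> trivIset [set` s] F ->
  (forall i w, F i w -> g w = a i) ->
  (\int[P]_w (g w)%:E = \sum_(i <- s) (a i)%:E * P (F i)
     + \int[P]_(w in ~` \big[setU/set0]_(i <- s) F i) (g w)%:E)%E.
Proof.
move=> mg us mF tF ga; set D := \big[setU/set0]_(i <- s) F i.
have mD : measurable D by exact: bigsetU_measurable.
rewrite -[X in (\int[P]_(w in X) _)%E = _](setUv D) integral_setU//; last 3 first.
- exact: measurableC.
- by apply/measurable_EFinP; exact: measurable_funTS.
- by apply/disj_set2P; rewrite setICr.
congr (_ + _)%E; rewrite integral_bigsetU_EFin//; last first.
  by apply/measurable_EFinP; exact: measurable_funTS.
apply: eq_bigr => i _; rewrite -integral_cst//.
by apply: eq_integral => w; rewrite inE => /ga ->.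
Qed.

Lemma probability_bigsetU (I : eqType) (s : seq I) (F : I -> set Omega) :
  uniq s -> (forall i, measurable (F i)) -> trivIset [set` s] F ->
  P (\big[setU/set0]_(i <- s) F i) = (\sum_(i <- s) P (F i))%E.
Proof.
move=> us mF tF; set D := \big[setU/set0]_(i <- s) F i.
have mD : measurable D by exact: bigsetU_measurable.
rewrite -[P D]mul1e -integral_cst// (integral_bigsetU_EFin _ (f := cst 1))//;
  last exact/measurable_EFinP/measurable_cst.
by apply: eq_bigr => i _; rewrite -[RHS]mul1e -integral_cst.
Qed.

End FiniteSplit.

Lemma measurable_discrete d (Omega : measurableType d) (R : realType)
    (T : countType) (Y : Omega -> T) (f : T -> R) :
  (forall t, measurable (Y @^-1` [set t])) -> measurable_fun [set: Omega] (f \o Y).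
Proof.
move=> mY _ B mB; rewrite setTI.
rewrite [X in measurable X](_ : _ = \bigcup_(t in [set: T])
    (if `[< B (f t) >] then Y @^-1` [set t] else set0)).
  by apply: countable_bigcupT_measurable; [exact: countableP|move=> t; case: ifP].
apply/seteqP; split=> [w /= Bw|w [t _]].
  by exists (Y w) => //; rewrite ifT//; exact/asboolP.
by case: ifPn => // /asboolP Bt /= Ywt; rewrite Ywt.
Qed.

Section Coloring.
Context d (Omega : measurableType d) (R : realType) (P : probability Omega R).
Context (V : finType) (c : nat) (X : V -> {RV P >-> nat}).
Hypothesis c_gt0 : (0 < c)%N.
Hypothesis unifX : uniform_coloring c X.

Let atom (x : V -> nat) : set Omega :=
  \bigcap_(v in [set` [set: V]%SET]) X v @^-1` [set x v].

Let atomE x w : atom x w <-> forall v, X v w = x v.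
Proof.
split=> [h v|h v _]; last exact: h.
by apply: h; rewrite /= inE.
Qed.

Let measurable_preimage v (B : set nat) : measurable (X v @^-1` B).
Proof. by rewrite -[X in measurable X]setTI; exact: measurable_funP. Qed.

Let measurable_atom x : measurable (atom x).
Proof.
by apply: fin_bigcap_measurable => // v _; exact: measurable_preimage.
Qed.

(** Any function of a coloring is measurable, since there are countably many
    colorings. *)
Lemma measurable_coloring_fun (F : (V -> nat) -> R) :
  measurable_fun [set: Omega] (fun w => F (fun v => X v w)).
Proof.
pose Y w : {ffun V -> nat} := [ffun v => X v w].
have XY w : (fun v => X v w) = Y w by apply/funext => v; rewrite ffunE.
under eq_fun do rewrite XY.
apply: (@measurable_discrete _ _ _ _ Y (fun x => F x)) => x.
rewrite (_ : _ @^-1` _ = atom x)//; apply/seteqP; split=> w /=.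
  by move=> Yx; apply/atomE => v; rewrite -Yx ffunE.
by move/atomE => Xx; apply/ffunP => v; rewrite ffunE.
Qed.

(** By independence each of the c ^ |V| colorings has probability c ^ - |V|, and
    the remaining colorings form a null event. *)
Lemma expectation_coloring (F : (V -> nat) -> R) :
  'E_P[fun w => F (fun v => X v w)]%E =
  (average (fun x : {ffun V -> 'I_c} => F (color x)))%:E.
Proof.
have [unif indep] := unifX.
have Patom (x : {ffun V -> 'I_c}) : P (atom (color x)) = ((c ^ #|V|)%:R^-1)%:E.
  rewrite /atom (indep [set: V]%SET (fun v => [set color x v]))//.
  rewrite (eq_bigr (fun=> (c%:R^-1)%:E)); last first.
    move=> v _; have := unif v (color x v).
    by rewrite /distribution /pushforward /= => ->; rewrite ltn_ord.
  rewrite prodEFin prodr_const cardsT; congr EFin.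
  by rewrite natrX exprVn.
have tA : trivIset [set` enum {: {ffun V -> 'I_c}}]
    (fun x : {ffun V -> 'I_c} => atom (color x)).
  apply/trivIsetP => x y _ _ xy; rewrite -subset0 => w.
  case=> /atomE hx /atomE hy; move/eqP: xy; apply; apply/ffunP => v.
  by have := hx v; rewrite hy /color => -[] /val_inj.
rewrite unlock.
rewrite (integral_split_atoms P (s := enum {: {ffun V -> 'I_c}})
  (F := fun x => atom (color x)) (a := fun x => F (color x)))//; last 3 first.
- exact: measurable_coloring_fun.
- exact: enum_uniq.
- by move=> x w /atomE hw; congr F; apply/funext => v; rewrite hw.
set G := \big[_/_]_(i <- _) _.
have PG : P G = 1%:E.
  rewrite probability_bigsetU ?enum_uniq//.
  rewrite big_enum/=; under eq_bigr do rewrite Patom.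
  rewrite sumEFin sumr_const card_ffun card_ord -[_^-1 *+ _]mulr_natr mulVf//.
  by rewrite pnatr_eq0 -lt0n expn_gt0 c_gt0.
have mG : measurable G by apply: bigsetU_measurable => x _.
rewrite null_set_integral ?adde0; last 3 first.
- exact: measurableC.
- by apply/measurable_EFinP; apply: measurable_funTS; exact: measurable_coloring_fun.
- by apply: (eq_trans (probability_setC P mG)); rewrite PG subee.
rewrite big_enum/= /average mulr_suml -sumEFin; apply: eq_bigr => x _.
by rewrite Patom.
Qed.

End Coloring.

(** * Convergence of atoms implies convergence in distribution *)

Definition atom_prob d (Omega : measurableType d) (R : realType)
    (P : probability Omega R) (T : Type) (Y : Omega -> T) (t : T) : R :=
  fine (P (Y @^-1` [set t])).

Section Truncation.
Context d (Omega : measurableType d) (R : realType) (P : probability Omega R).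
Context (Y : Omega -> nat).
Hypothesis mY : forall k, measurable (Y @^-1` [set k]).

Let trivIset_atoms (D : set nat) : trivIset D (fun k => Y @^-1` [set k]).
Proof. by apply/trivIsetP => i j _ _ /eqP ij; rewrite -subset0 => w [/= -> /ij]. Qed.

Let PE k : P (Y @^-1` [set k]) = (atom_prob P Y k)%:E.
Proof. by rewrite /atom_prob fineK// fin_num_measure. Qed.

Lemma expectation_truncation (f : nat -> R) (C : R) (K : nat) :
  (forall k, `|f k| <= C) ->
  'E_P[f \o Y]%E \is a fin_num /\
  `|fine 'E_P[f \o Y]%E - \sum_(0 <= k < K) f k * atom_prob P Y k| <=
    C * (1 - \sum_(0 <= k < K) atom_prob P Y k).
Proof.
move=> fC; set S := \sum_(0 <= k < K) f k * _; set Q := \sum_(0 <= k < K) _.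
rewrite unlock.
rewrite (integral_split_atoms P (s := index_iota 0 K) (F := fun k => Y @^-1` [set k])
  (a := f))//; last 3 first.
- exact: measurable_discrete.
- exact: iota_uniq.
- by move=> k w /= ->.
set D := \big[_/_]_(i <- _) _.
have mD : measurable D by exact: bigsetU_measurable.
have PD : P (~` D) = (1 - Q)%:E.
  rewrite probability_setC// probability_bigsetU ?iota_uniq//.
  by under eq_bigr do rewrite PE; rewrite sumEFin.
under eq_bigr do rewrite PE.
rewrite (_ : \sum_(i <- _) _ = S%:E)%E; last by rewrite -sumEFin.
set J := (\int[P]_(w in ~` D) _)%E.
have J_le : (`|J| <= (C * (1 - Q))%:E)%E.
  apply: le_trans (le_abse_integral _ _ _) _ => //.
  - exact: measurableC.
  - by apply/measurable_EFinP; apply: measurable_funTS; exact: measurable_discrete.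
  rewrite EFinM -PD -integral_cst//; last exact: measurableC.
  apply: ge0_le_integral => //.
  - exact: measurableC.
  - apply/measurable_EFinP; apply: measurableT_comp => //.
    by apply: measurable_funTS; exact: measurable_discrete.
  - by move=> w _ /=; rewrite lee_fin fC.
have Jfin : J \is a fin_num.
  by rewrite fin_num_abs (le_lt_trans J_le)// ltry.
split; first by rewrite fin_numD Jfin.
by rewrite fineD//= addrAC subrr add0r -lee_fin -abse_EFin fineK.
Qed.

Lemma cvg_sum_atom_prob :
  (\sum_(0 <= k < K) atom_prob P Y k) @[K --> \oo] --> (1 : R).
Proof.
have UY : \bigcup_k Y @^-1` [set k] = [set: Omega].
  by apply/seteqP; split => w // _; exists (Y w).
have h : (fun K => (\sum_(0 <= k < K) P (Y @^-1` [set k]))%E) @ \oo --> 1%:E.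
  rewrite -(probability_setT P).
  have := @measure_semi_sigma_additive _ _ _ P (fun k => Y @^-1` [set k]) mY
    (@trivIset_atoms setT).
  by rewrite UY; exact.
rewrite [X in X @ _](_ : _ =
    fine \o (fun K => (\sum_(0 <= k < K) P (Y @^-1` [set k]))%E)).
  exact: (fine_cvg h).
by apply/funext => K /=; under [in RHS]eq_bigr do rewrite PE; rewrite sumEFin.
Qed.

End Truncation.

(** Scheffe's argument: the limit has total mass 1, so finitely many values carry
    almost all the mass of the limit and hence, by convergence of the atoms,
    of the approximating laws. *)
Lemma cvg_expectation_nat (R : realType) (d : nat -> measure_display)
    (Omega : forall n, measurableType (d n)) (P : forall n, probability (Omega n) R)
    (Y : forall n, Omega n -> nat)
    (d' : measure_display) (Omega' : measurableType d')
    (P' : probability Omega' R) (Z : Omega' -> nat) (f : nat -> R) (C : R) :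
  (forall n k, measurable (Y n @^-1` [set k])) ->
  (forall k, measurable (Z @^-1` [set k])) ->
  (forall k, `|f k| <= C) ->
  (forall k, atom_prob (P n) (Y n) k @[n --> \oo] --> atom_prob P' Z k) ->
  ('E_(P n)[f \o Y n] @[n --> \oo] --> 'E_P'[f \o Z])%E.
Proof.
move=> mY mZ fC YZ.
have Yt n K := expectation_truncation (P n) (mY n) K fC.
have Zt K := expectation_truncation P' mZ K fC.
rewrite -(fineK (Zt 0%N).1); apply/fine_cvgP; split.
  by apply: nearW => n; exact: (Yt n 0%N).1.
apply/cvgrPdist_le => e e0 /=; pose e4 := e / 4.
have e40 : 0 < e4 by rewrite divr_gt0.
pose s K := \sum_(0 <= k < K) atom_prob P' Z k.
have Cs : C * (1 - s K) @[K --> \oo] --> C * (1 - 1).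
  apply: cvgM; first exact: cvg_cst.
  by apply: cvgB; [exact: cvg_cst|exact: cvg_sum_atom_prob].
have [K CK] : exists K, C * (1 - s K) < e4.
  have : \forall K \near \oo, C * (1 - s K) < e4.
    by apply: (cvgr_lt _ Cs); rewrite subrr mulr0.
  by case=> N _ /(_ N (leqnn N)); exists N.
pose sn n := \sum_(0 <= k < K) atom_prob (P n) (Y n) k.
have sns : sn @ \oo --> s K by apply: cvg_sumr => k; exact: YZ.
have fsns : (\sum_(0 <= k < K) f k * atom_prob (P n) (Y n) k) @[n --> \oo] -->
    \sum_(0 <= k < K) f k * atom_prob P' Z k.
  by apply: cvg_sumr => k; apply: cvgM; [exact: cvg_cst|exact: YZ].
near=> n.
have h1 := (Zt K).2; have h2 := (Yt n K).2.
have h3 : `|\sum_(0 <= k < K) f k * atom_prob P' Z k -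
   \sum_(0 <= k < K) f k * atom_prob (P n) (Y n) k| <= e4.
  by near: n; move/cvgrPdist_le : fsns; exact.
have h4 : C * (1 - sn n) < e4.
  near: n; apply: (@cvgr_lt _ _ _ _ _ (C * (1 - s K))) => //.
  by apply: cvgM; [exact: cvg_cst|apply: cvgB => //; exact: cvg_cst].
rewrite -/(s K) in h1; rewrite -/(sn n) in h2.
set EZ := fine _ in h1 *; set EY := fine _ in h2 *.
set a := \sum_(0 <= k < K) _ in h1 h3; set b := \sum_(0 <= k < K) _ in h2 h3.
rewrite (_ : EZ - EY = (EZ - a) + (a - b) - (EY - b)); last by ring.
apply: le_trans (ler_normB _ _) _; apply: le_trans (lerD (ler_normD _ _) (lexx _)) _.
by move: (CK) h1 h2 h3 h4; rewrite /e4; lra.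
Unshelve. all: by end_near. Qed.

(** Reduction to natural numbers by enumerating the countable type. *)
Lemma cvg_expectation_discrete (R : realType) (T : countType) (d : nat -> measure_display)
    (Omega : forall n, measurableType (d n)) (P : forall n, probability (Omega n) R)
    (Y : forall n, Omega n -> T)
    (d' : measure_display) (Omega' : measurableType d')
    (P' : probability Omega' R) (Z : Omega' -> T) (f : T -> R) (C : R) :
  (forall n t, measurable (Y n @^-1` [set t])) ->
  (forall t, measurable (Z @^-1` [set t])) ->
  (forall t, `|f t| <= C) ->
  (forall t, atom_prob (P n) (Y n) t @[n --> \oo] --> atom_prob P' Z t) ->
  ('E_(P n)[f \o Y n] @[n --> \oo] --> 'E_P'[f \o Z])%E.
Proof.
move=> mY mZ fC YZ.
pose g k := if (unpickle k : option T) is Some t then f t else 0.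
have fg (W : Type) (U : W -> T) : f \o U = g \o (pickle \o U).
  by apply/funext => w; rewrite /g /= pickleK.
have preim (W : Type) (U : W -> T) k : (pickle \o U) @^-1` [set k] =
    if (pickle_inv k : option T) is Some t then U @^-1` [set t] else set0.
  apply/seteqP; split=> w /=.
    by move=> <-; rewrite pickleK_inv.
  by have := @pickle_invK T k; case: (pickle_inv k) => //= t <- ->.
rewrite fg; under eq_fun do rewrite fg.
apply: (@cvg_expectation_nat _ _ _ _ _ _ _ _ _ _ `|C|).
- by move=> n k; rewrite preim; case: pickle_inv.
- by move=> k; rewrite preim; case: pickle_inv.
- move=> k; rewrite /g; case: unpickle => [t|]; last by rewrite normr0.
  exact: le_trans (fC t) (ler_norm _).
- move=> k; rewrite /atom_prob preim; under eq_fun do rewrite preim.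
  case: pickle_inv => [t|]; first exact: YZ.
  by under eq_fun do rewrite measure0; rewrite measure0; exact: cvg_cst.
Qed.

(** * Asymptotics of the coloring model *)

Section Mass.
Context (R : realFieldType) (V : finType) (c : nat).
Hypothesis c_gt0 : (0 < c)%N.
Implicit Types (A B : {set {set V}}).

Lemma joint_box A B K (x : {ffun V -> 'I_c}) :
  \sum_(k < K) \sum_(l < K) (joint A B k l x)%:R =
  ((edge_count A x < K)%N && (edge_count B x < K)%N)%:R :> R.
Proof.
have sum_eq N : \sum_(k < K) (N == k :> nat)%:R = (N < K)%N%:R :> R.
  have [NK|KN] := ltnP N K.
    rewrite (bigD1 (Ordinal NK))//= eqxx big1 ?addr0// => k.
    by rewrite eq_sym -val_eqE/= => /negPf ->.
  by rewrite big1// => k _; rewrite gtn_eqF// (leq_trans (ltn_ord k)).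
under eq_bigr => k _.
  under eq_bigr do rewrite /joint -mulnb natrM.
  by rewrite -mulr_sumr sum_eq; over.
by rewrite -mulr_suml sum_eq -natrM mulnb.
Qed.

(** Lower bound by Markov's inequality: if (N1, N2) lies outside the box then
    N1 + N2 >= K + 1. *)
Lemma joint_mass A B K :
  (forall e, e \in A -> (0 < #|e|)%N) -> (forall e, e \in B -> (0 < #|e|)%N) ->
  1 - (mean R c A + mean R c B) / K.+1%:R <=
    \sum_(k < K.+1) \sum_(l < K.+1)
      average (fun x : {ffun V -> 'I_c} => (joint A B k l x)%:R : R) <= 1.
Proof.
move=> A0 B0.
under eq_bigr do rewrite -average_sum.
rewrite -average_sum (eq_average (@joint_box A B K.+1)); apply/andP; split; last first.
  rewrite -[leRHS](average_cst V c_gt0 (1 : R)); apply: ler_average => x.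
  by rewrite lern1 leq_b1.
rewrite -!average_edge_count// -averageD mulrC -averageZ.
rewrite -[X in X - _](average_cst V c_gt0 (1 : R)) -averageB.
apply: ler_average => x; rewrite -natrD lerBlDr.
have K0 : 0 < K.+1%:R :> R by rewrite ltr0n.
case: (ltnP (edge_count A x) K.+1) => [hA|hA]; last first.
  by rewrite add0r mulrC ler_pdivlMr// mul1r ler_nat (leq_trans hA)// leq_addr.
case: (ltnP (edge_count B x) K.+1) => [hB|hB]; last first.
  by rewrite add0r mulrC ler_pdivlMr// mul1r ler_nat (leq_trans hB)// leq_addl.
by rewrite lerDl mulr_ge0// invr_ge0 ltW.
Qed.

Lemma joint_sym A B k l (x : {ffun V -> 'I_c}) : joint A B k l x = joint B A l k x.
Proof. by rewrite /joint andbC. Qed.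

End Mass.

Section Limit.
Context (R : realType).

Lemma cvg_inv_nat (c : nat -> nat) : c n @[n --> \oo] --> \oo ->
  ((c n)%:R^-1 : R) @[n --> \oo] --> (0 : R).
Proof.
move=> /cvgnyPge hc; apply/cvgr0Pnorm_le => e e0; near=> n.
rewrite ger0_norm ?invr_ge0//.
have c1 : ((Num.truncn e^-1).+1 <= c n)%N by near: n; exact: hc.
have c0 : 0 < (c n)%:R :> R by rewrite ltr0n (leq_trans _ c1).
rewrite -[e]invrK lef_pV2 ?posrE ?invr_gt0//.
apply: ltW; apply: lt_le_trans (truncnS_gt _) _.
by rewrite ler_nat.
Unshelve. all: by end_near. Qed.

(** The bounds available depend on a free parameter [delta] and tend to a
    multiple of it. *)
Lemma cvg0_tradeoff (u : nat -> R) (f : R -> nat -> R) (G : R) :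
  (forall n, 0 <= u n) ->
  (forall delta, 0 < delta -> \forall n \near \oo, u n <= f delta n) ->
  (forall delta, 0 < delta -> f delta @ \oo --> delta * G) ->
  u @ \oo --> 0.
Proof.
move=> u0 uf fG; apply/cvgr0Pnorm_le => e e0.
pose delta := e / (`|G| + 1).
have G1 : 0 < `|G| + 1 by rewrite ltr_wpDl.
have d0 : 0 < delta by rewrite divr_gt0.
have dG : delta * G < e.
  rewrite /delta mulrAC ltr_pdivrMr// ltr_pM2l//.
  by rewrite (le_lt_trans (ler_norm _))// ltrDl.
near=> n; rewrite ger0_norm//; apply: (@le_trans _ _ (f delta n)).
  by near: n; exact: uf.
by apply: ltW; near: n; exact: (cvgr_lt _ (fG delta d0)).
Unshelve. all: by end_near. Qed.

Section Model.
Context (r1 r2 : nat) (V : nat -> finType) (c : nat -> nat).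
Context (A B : forall n, {set {set V n}}) (lambda1 lambda2 : R).
Hypothesis r1_gt1 : (1 < r1)%N.
Hypothesis r12 : (r1 < r2)%N.
Hypothesis c_oo : c n @[n --> \oo] --> \oo.
Hypothesis A_unif : forall n e, e \in A n -> #|e| = r1.
Hypothesis B_unif : forall n e, e \in B n -> #|e| = r2.

Let q n : R := (c n)%:R^-1.
Let mean_of (E : forall n, {set {set V n}}) n : R := mean R (c n) (E n).
Let var_of (E : forall n, {set {set V n}}) n : R :=
  average (fun x : {ffun V n -> 'I_(c n)} =>
    ((edge_count (E n) x)%:R - mean_of E n) ^+ 2).

Hypothesis meanA : mean_of A @ \oo --> lambda1.
Hypothesis meanB : mean_of B @ \oo --> lambda2.
Hypothesis varA : var_of A @ \oo --> lambda1.
Hypothesis varB : var_of B @ \oo --> lambda2.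

Let near_c k : \forall n \near \oo, (k <= c n)%N.
Proof. by move/cvgnyPge : c_oo; exact. Qed.

Let q0 : q @ \oo --> (0 : R).
Proof. exact: cvg_inv_nat. Qed.

(** The variance bound gives overlap <= Var / (1 - q) - E, and both terms have
    the same limit. *)
Lemma cvg_overlap_self (E : forall n, {set {set V n}}) (lambda : R) :
  (forall n e, e \in E n -> (1 < #|e|)%N) ->
  mean_of E @ \oo --> lambda -> var_of E @ \oo --> lambda ->
  (overlap R (c n) (E n) (E n)) @[n --> \oo] --> 0.
Proof.
move=> E1 mE vE.
apply: (@squeeze_cvgr _ _ _ _ (cst 0) (fun n => var_of E n / (1 - q n) - mean_of E n)).
- near=> n; rewrite overlap_ge0/=.
  have c2 : (2 <= c n)%N by near: n; exact: near_c.
  have c0 : (0 < c n)%N by exact: ltnW.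
  have q1 : 0 < 1 - q n.
    by rewrite subr_gt0 invf_lt1 ?ltr0n// ltr1n.
  rewrite lerBrDl ler_pdivlMr// [leLHS]mulrC; exact: (overlap_le_variance _ c0 (E1 n)).
- exact: cvg_cst.
- have -> : 0 = lambda / (1 - 0) - lambda by rewrite subr0 divr1 subrr.
  apply: cvgB => //; apply: cvgM => //; apply: cvgV; first by rewrite subr0 oner_neq0.
  by apply: cvgB => //; exact: cvg_cst.
Unshelve. all: by end_near. Qed.

Let A1 n e : e \in A n -> (1 < #|e|)%N.
Proof. by move=> /A_unif ->. Qed.

Let B1 n e : e \in B n -> (1 < #|e|)%N.
Proof. by move=> /B_unif ->; exact: ltn_trans r12. Qed.

Lemma cvg_overlap_cross : overlap R (c n) (A n) (B n) @[n --> \oo] --> 0.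
Proof.
have oA := cvg_overlap_self A1 meanA varA.
have oB := cvg_overlap_self B1 meanB varB.
apply: (@cvg0_tradeoff _ (fun delta n =>
  delta * (2 ^+ r1 * (overlap R (c n) (A n) (A n) + mean_of A n)) +
  delta^-1 * (2 ^+ r2 * (overlap R (c n) (B n) (B n) + q n * mean_of B n)))
  (2 ^+ r1 * lambda1)).
- by move=> n; exact: overlap_ge0.
- move=> delta d0; near=> n; apply: cross_overlap r12 d0 _ _.
  + by near: n; exact: near_c.
  + by move=> e; exact: A_unif.
  + by move=> e; exact: B_unif.
- move=> delta d0.
  have -> : delta * (2 ^+ r1 * lambda1) = delta * (2 ^+ r1 * (0 + lambda1)) +
      delta^-1 * (2 ^+ r2 * (0 + 0 * lambda2)) by ring.
  by repeat first [exact: cvg_cst | exact: oA | exact: oB | exact: q0 |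
    exact: meanA | exact: meanB | apply: cvgD | apply: cvgM].
Unshelve. all: by end_near. Qed.

Let E n : {set {set V n}} := A n :|: B n.

Let AB n : [disjoint A n & B n]%bool.
Proof.
apply/pred0P => e /=; apply/negP => /andP[/A_unif e1 /B_unif e2].
by move: r12; rewrite -e1 e2 ltnn.
Qed.

Let E_size n e : e \in E n -> (1 < #|e| <= r2)%N.
Proof.
case/setUP => he; first by rewrite A1// (A_unif he) ltnW.
by rewrite B1// (B_unif he) leqnn.
Qed.

Let error delta n : R :=
  q n * mean_of E n + 2 * (overlap R (c n) (E n) (E n) + r2%:R * delta * mean_of E n +
    (r2%:R * mean_of E n) ^+ 2 *
    (delta + q n * (overlap R (c n) (E n) (E n) + mean_of E n) / delta ^+ 3)).

Lemma cvg_error (delta : R) : error delta @ \oo -->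
  delta * (2 * (r2%:R * (lambda1 + lambda2) + (r2%:R * (lambda1 + lambda2)) ^+ 2)).
Proof.
have mE : mean_of E @ \oo --> lambda1 + lambda2.
  rewrite /mean_of /E; under eq_fun do rewrite mean_setU//.
  by apply: cvgD; [exact: meanA|exact: meanB].
have oE : overlap R (c n) (E n) (E n) @[n --> \oo] --> (0 + 0 + 2 * 0 : R).
  under eq_fun do rewrite overlap_setU//.
  apply: cvgD; first apply: cvgD.
  - exact: cvg_overlap_self A1 meanA varA.
  - exact: cvg_overlap_self B1 meanB varB.
  - by apply: cvgM; [exact: cvg_cst|exact: cvg_overlap_cross].
set L := lambda1 + lambda2 in mE *.
have -> : delta * (2 * (r2%:R * L + (r2%:R * L) ^+ 2)) =
  0 * L + 2 * ((0 + 0 + 2 * 0) + r2%:R * delta * L + (r2%:R * L) * (r2%:R * L) *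
    (delta + 0 * ((0 + 0 + 2 * 0) + L) / delta ^+ 3)) by ring.
rewrite /error; under eq_fun do rewrite expr2.
by repeat first [exact: cvg_cst | exact: mE | exact: oE | exact: q0 |
    apply: cvgD | apply: cvgM].
Qed.

Let pmf n k l : R := average (fun x : {ffun V n -> 'I_(c n)} =>
  (joint (A n) (B n) k l x)%:R).

(** [stein_identity], used once for each layer with the union of the layers as
    the family of edges that may change, supplies the recurrences. *)
Lemma cvg_joint k l :
  pmf n k l @[n --> \oo] --> poisson_weight lambda1 k * poisson_weight lambda2 l.
Proof.
have norm_cvg0 (u : nat -> R) :
    (forall delta, 0 < delta -> \forall n \near \oo, `|u n| <= error delta n) ->
    u @ \oo --> 0.
  move=> u_le; apply/norm_cvg0P.
  by apply: (cvg0_tradeoff _ u_le) => // delta _; exact: cvg_error.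
apply: (cvg_poisson_recurrence meanA meanB).
- by move=> n i j; apply: average_ge0 => x; rewrite ler0n.
- move=> {}k {}l; apply: norm_cvg0 => delta d0; near=> n.
  apply: stein_identity => //.
  + by near: n; exact: near_c.
  + exact: finset.subsetUl.
  + exact: finset.subsetUr.
  + by move=> e; exact: E_size.
- move=> {}k {}l; apply: norm_cvg0 => delta d0; near=> n.
  have sym i j : pmf n i j = average (fun x : {ffun V n -> 'I_(c n)} =>
      (joint (B n) (A n) j i x)%:R).
    by apply: eq_average => x; rewrite joint_sym.
  rewrite !sym.
  apply: stein_identity => //.
  + by near: n; exact: near_c.
  + exact: finset.subsetUr.
  + exact: finset.subsetUl.
  + by rewrite disjoint_sym.
  + by move=> e; exact: E_size.
- move=> K; near=> n; apply: joint_mass.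
  + by near: n; exact: near_c.
  + by move=> e /A1; exact: ltnW.
  + by move=> e /B1; exact: ltnW.
Unshelve. all: by end_near. Qed.

End Model.
End Limit.

(** * Monochromatic edges of random colorings *)

Lemma poisson_atom d (Omega : measurableType d) (R : realType)
    (P : probability Omega R) (Z : {RV P >-> nat}) (lambda : R) k :
  0 <= lambda -> has_poisson_law Z lambda ->
  P (Z @^-1` [set k]) = (poisson_weight lambda k)%:E.
Proof.
move=> l0 /(_ [set k]); rewrite /distribution /pushforward /= => ->.
rewrite /poisson_prob /poisson_weight; case: ltP => [lpos|lneg].
  rewrite esum_set1; last by rewrite lee_fin poisson_pmf_ge0.
  by rewrite /poisson_pmf lpos mulrC.
have -> : lambda = 0 by apply/eqP; rewrite eq_le lneg.
rewrite diracE oppr0 expR0 mul1r; case: k => [|k].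
  by rewrite mem_set// expr0 fact0 invr1 mulr1.
by rewrite memNset// expr0n mul0r.
Qed.

Section HypergraphColoring.
Context d (Omega : measurableType d) (R : realType) (P : probability Omega R).
Context (V : finType) (c : nat) (X : V -> {RV P >-> nat}).
Hypothesis c_gt0 : (0 < c)%N.
Hypothesis unifX : uniform_coloring c X.

Lemma expectation_T_mono r (H : uniform_hypergraph r V) : (0 < r)%N ->
  'E_P[T_mono H X]%E = (mean R c (hyperedges H))%:E.
Proof.
move=> r0; rewrite /T_mono.
rewrite (expectation_coloring c_gt0 unifX (fun x => (nb_monochromatic H x)%:R)).
rewrite -(average_edge_count R c_gt0)//.
by move=> e eH; rewrite (card_hyperedge eH).
Qed.

Lemma variance_T_mono r (H : uniform_hypergraph r V) : (0 < r)%N ->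
  'V_P[T_mono H X]%E = (average (fun x : {ffun V -> 'I_c} =>
    ((edge_count (hyperedges H) x)%:R - mean R c (hyperedges H)) ^+ 2))%:E.
Proof.
move=> r0; rewrite /variance covariance.unlock expectation_T_mono//=.
rewrite (_ : _ * _ = fun w =>
  ((nb_monochromatic H (fun v => X v w))%:R - mean R c (hyperedges H)) ^+ 2)//.
exact: (expectation_coloring c_gt0 unifX
  (fun x => ((nb_monochromatic H x)%:R - mean R c (hyperedges H)) ^+ 2)).
Qed.

End HypergraphColoring.

Section Counts.
Context d (Omega : measurableType d) (R : realType) (P : probability Omega R).
Context (V : finType) (c : nat) (X : V -> {RV P >-> nat}).
Context (r1 r2 : nat) (H1 : uniform_hypergraph r1 V) (H2 : uniform_hypergraph r2 V).

Definition mono_counts (w : Omega) : nat * nat :=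
  (nb_monochromatic H1 (fun v => X v w), nb_monochromatic H2 (fun v => X v w)).

Let indicator_counts kl : \1_(mono_counts @^-1` [set kl]) =
  (fun w => ((nb_monochromatic H1 (fun v => X v w) == kl.1) &&
             (nb_monochromatic H2 (fun v => X v w) == kl.2))%:R) :> (Omega -> R).
Proof.
apply/funext => w; rewrite indicE; congr (_%:R); congr nat_of_bool.
by case: kl => k l; apply/idP/idP; rewrite inE /mono_counts /= -xpair_eqE => /eqP.
Qed.

Lemma measurable_mono_counts kl : measurable (mono_counts @^-1` [set kl]).
Proof.
have m1 : measurable_fun [set: Omega] (\1_(mono_counts @^-1` [set kl]) : Omega -> R).
  rewrite indicator_counts.
  exact: (measurable_coloring_fun X (fun x => ((nb_monochromatic H1 x == kl.1) &&
             (nb_monochromatic H2 x == kl.2))%:R)).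
have := m1 measurableT [set 1] (measurable_set1 1); rewrite setTI.
congr measurable; apply/seteqP; split=> w /=; rewrite indicE.
  by case: (boolP (w \in _)) => [/set_mem//|_] /= /esym/eqP; rewrite oner_eq0.
by move=> hw; rewrite mem_set.
Qed.

Lemma mono_counts_atom_prob k l : (0 < c)%N -> uniform_coloring c X ->
  atom_prob P mono_counts (k, l) =
  average (fun x : {ffun V -> 'I_c} =>
    (joint (hyperedges H1) (hyperedges H2) k l x)%:R).
Proof.
move=> c0 uX; rewrite /atom_prob -expectation_indic; last exact: measurable_mono_counts.
rewrite indicator_counts.
by rewrite (expectation_coloring c0 uX (fun x => ((nb_monochromatic H1 x == k) &&
             (nb_monochromatic H2 x == l))%:R)).
Qed.

End Counts.

Theorem mainTheorem3 (R : realType) (r1 r2 : nat)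
    (hr1 : (2 <= r1)%N) (hr12 : (r1 < r2)%N)
    (H : nat -> hypermultiplex2 r1 r2)
    (c : nat -> nat) (hc : c n @[n --> \oo] --> \oo)
    (d : nat -> measure_display) (Omega : forall n, measurableType (d n))
    (P : forall n, probability (Omega n) R)
    (X : forall n, vertices (H n) -> {RV (P n) >-> nat})
    (hX : forall n, uniform_coloring (c n) (X n))
    (lambda1 lambda2 : R) (hl1 : 0 <= lambda1) (hl2 : 0 <= lambda2)
    (hE1 : ('E_(P n)[T_mono (layer1 (H n)) (X n)] @[n --> \oo]
              --> lambda1%:E)%E)
    (hV1 : ('V_(P n)[T_mono (layer1 (H n)) (X n)] @[n --> \oo]
              --> lambda1%:E)%E)
    (hE2 : ('E_(P n)[T_mono (layer2 (H n)) (X n)] @[n --> \oo]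
              --> lambda2%:E)%E)
    (hV2 : ('V_(P n)[T_mono (layer2 (H n)) (X n)] @[n --> \oo]
              --> lambda2%:E)%E)
    (d' : measure_display) (Omega' : measurableType d')
    (P' : probability Omega' R) (Z1 Z2 : {RV P' >-> nat})
    (hZ1 : has_poisson_law Z1 lambda1) (hZ2 : has_poisson_law Z2 lambda2)
    (hZ : independent Z1 Z2) :
  cvg_in_distribution P
    (fun n w => (T_mono (layer1 (H n)) (X n) w, T_mono (layer2 (H n)) (X n) w))
    P' (fun w => ((Z1 w)%:R : R, (Z2 w)%:R : R)).
Proof.
move=> f _ [M [_ Mf]].
have r1_gt0 : (0 < r1)%N by exact: ltnW.
have r2_gt0 : (0 < r2)%N by exact: leq_ltn_trans hr12.
have c_gt0 : \forall n \near \oo, (0 < c n)%N by move/cvgnyPge : hc; exact.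
(* the formulas for the moments require c n > 0, which holds eventually *)
have fin_cvg (u : nat -> \bar R) (v : nat -> R) (l : R) :
    (forall n, (0 < c n)%N -> u n = (v n)%:E) -> u @ \oo --> l%:E -> v @ \oo --> l.
  move=> uv /fine_cvg; apply: cvg_trans; apply: near_eq_cvg.
  by apply: filterS c_gt0 => n c0 /=; rewrite uv.
have meanA := fin_cvg _ _ _ (fun n c0 =>
  expectation_T_mono c0 (hX n) (layer1 (H n)) r1_gt0) hE1.
have meanB := fin_cvg _ _ _ (fun n c0 =>
  expectation_T_mono c0 (hX n) (layer2 (H n)) r2_gt0) hE2.
have varA := fin_cvg _ _ _ (fun n c0 =>
  variance_T_mono c0 (hX n) (layer1 (H n)) r1_gt0) hV1.
have varB := fin_cvg _ _ _ (fun n c0 =>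
  variance_T_mono c0 (hX n) (layer2 (H n)) r2_gt0) hV2.
have mZ k (Z : {RV P' >-> nat}) : measurable (Z @^-1` [set k]).
  by rewrite -[X in measurable X]setTI; exact: measurable_funP.
have Zpre kl : (fun w => (Z1 w, Z2 w)) @^-1` [set kl] =
    (Z1 @^-1` [set kl.1]) `&` (Z2 @^-1` [set kl.2]).
  by apply/seteqP; case: kl => k l; split=> w /= [-> ->].
apply: (@cvg_expectation_discrete R (nat * nat)%type d Omega P
  (fun n => mono_counts (X n) (layer1 (H n)) (layer2 (H n))) d' Omega' P'
  (fun w => (Z1 w, Z2 w)) (fun kl => f (kl.1%:R, kl.2%:R)) (M + 1)).
- by move=> n kl; exact: measurable_mono_counts.
- by move=> kl; rewrite Zpre; apply: measurableI; exact: mZ.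
- by move=> kl; apply: Mf; rewrite ?ltrDl.
- case=> k l; rewrite /atom_prob Zpre /= hZ// !(poisson_atom _ _ hZ1, poisson_atom _ _ hZ2)//=.
  have := @cvg_joint R _ _ _ c _ _ _ _ hr1 hr12 hc (fun n => @card_hyperedge _ _ (layer1 (H n)))
    (fun n => @card_hyperedge _ _ (layer2 (H n))) meanA meanB varA varB k l.
  apply: cvg_trans; apply: near_eq_cvg; apply: filterS c_gt0 => n c0.
  by rewrite -(mono_counts_atom_prob _ _ _ _ c0 (hX n)).
Qed.
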